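(* Let $X$ be a topological space, let $T:X\to X$ be a continuous map, let $p\ge 1$, let $g_1,\dots,g_p$ be elements of an abelian compact topological group $G$, put $\mathbf g=(g_1,\dots,g_p)$ and let $\mathbf d=(d_1,\dots,d_p)\in\mathbb N^p$. Assume also that there is a nonempty subset $Y$ of $\mathcal U(T)$ such that $T(Y)\subset Y$ and $Y$ is path connected, locally path connected and simply connected. Then $X\times\{(1_G,\dots,1_G)\}\subset N_u^{\mathbf g,\mathbf d}$ for every $u\in Y$.
   Context: $\mathbb N$ denotes the positive integers and $1_G$ the identity of $G$. A vector (point) $x\in X$ is universal for $T$ if $\{T^n x;\ n\geq 1\}$ is dense in $X$; $\mathcal U(T)$ denotes the set of universal vectors for $T$. For $u\in X$, $$N_u^{\mathbf g,\mathbf d}=\overline{\left\{(T^n u,\ g_1^{n^{d_1}},g_1^{n^{d_1-1}},\dots,g_1^{n},\ g_2^{n^{d_2}},\dots,g_2^{n},\ \dots,\ g_p^{n^{d_p}},\dots,g_p^{n});\ n\geq 1\right\}}\subset X\times G^{d_1+\dots+d_p},$$ where, for each $j$, the exponents of $g_j$ are successively $n^{d_j},n^{d_j-1},\dots,n$; $(1_G,\dots,1_G)$ is the identity of $G^{d_1+\dots+d_p}$. *)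

(* Defs.v *)
From HB Require Import structures.
From mathcomp Require Import all_boot all_order all_algebra.
From mathcomp Require Import all_classical all_reals all_analysis.
From mathcomp Require Import homotopy.
Set Implicit Arguments.
Unset Strict Implicit.
Unset Printing Implicit Defensive.

Import Order.TTheory GRing.Theory Num.Theory.
Import numFieldNormedType.Exports.
Local Open Scope classical_set_scope.
Local Open Scope ring_scope.

Section UnitInterval.
Variable R : realType.

Definition unit_itv : Type := set_type [set` `[0 : R, 1]].

HB.instance Definition _ := Topological.on unit_itv.

Lemma unit_itv_mem0 : (0 : R) \in [set` `[0 : R, 1]].
Proof. by apply/mem_set; rewrite /= in_itv /= lexx ler01. Qed.

Lemma unit_itv_mem1 : (1 : R) \in [set` `[0 : R, 1]].
Proof. by apply/mem_set; rewrite /= in_itv /= ler01 lexx. Qed.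

Definition unit_itv0 : unit_itv := exist _ 0 unit_itv_mem0.
Definition unit_itv1 : unit_itv := exist _ 1 unit_itv_mem1.

Lemma unit_itv0_neq1 : unit_itv0 != unit_itv1.
Proof. by apply/eqP => -[] /eqP; rewrite eq_sym oner_eq0. Qed.

HB.instance Definition _ := isBiPointed.Build unit_itv unit_itv0_neq1.

End UnitInterval.

(* The predicates below are properties of a space; for a subset Y of a space
   they are applied to the type Y, which carries the subspace topology. *)

Definition path_connected (R : realType) (T : topologicalType) : Prop :=
  [set: T] !=set0 /\
  forall x y : T, inhabited {path unit_itv R from x to y in T}.

Definition locally_path_connected (R : realType) (T : topologicalType) : Prop :=
  forall (x : T) (U : set T), nbhs x U ->
  exists V : set T, [/\ open_nbhs x V, V `<=` U & path_connected R V].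

Definition path_homotopic (R : realType) (T : topologicalType) (x y : T)
    (f g : {path unit_itv R from x to y in T}) : Prop :=
  exists H : unit_itv R * unit_itv R -> T,
  [/\ continuous H,
      forall s, H (s, zero) = f s,
      forall s, H (s, one) = g s,
      forall t, H (zero, t) = x
    & forall t, H (one, t) = y].

Definition simply_connected (R : realType) (T : topologicalType) : Prop :=
  path_connected R T /\
  forall (x : T) (f : {path unit_itv R from x to x in T}),
    path_homotopic f (cst x).

Definition universal (X : topologicalType) (T : X -> X) : set X :=
  [set x | dense [set y | exists2 n, (1 <= n)%N & y = iter n T x]].

(* The abelian group G is written additively: g *+ m stands for g^m and 0 for
   the identity. The coordinates of G^(d_1 + ... + d_p) are indexed by the pairs
   (j, k) with k < d j; coordinate (j, k) carries the exponent n^(d j - k), so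
   that, for each j, the exponents run through n^(d j), ..., n. *)
Definition phase_index (p : nat) (d : 'I_p -> nat) : Type :=
  {j : 'I_p & 'I_(d j)}.

Definition phases (G : topologicalZmodType) (p : nat) (g : 'I_p -> G)
    (d : 'I_p -> nat) (n : nat) : {ptws phase_index d -> G} :=
  fun i => g (tag i) *+ (n ^ (d (tag i) - tagged i))%N.
Arguments phases {G p} g d n.

Definition orbit_closure (X : topologicalType) (G : topologicalZmodType)
    (T : X -> X) (p : nat) (g : 'I_p -> G) (d : 'I_p -> nat) (u : X) :
    set (X * {ptws phase_index d -> G})%type :=
  closure [set z : X * {ptws phase_index d -> G} |
    exists2 n, (1 <= n)%N & z = (iter n T u, phases g d n)].
Arguments orbit_closure {X G} T {p} g d u _.

(* Main.v *)
Require Import Defs.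
From HB Require Import structures.
From mathcomp Require Import all_boot all_order all_algebra.
From mathcomp Require Import all_classical all_reals all_analysis.
From mathcomp Require Import homotopy.
From mathcomp Require Import ring lra zify.
Set Implicit Arguments.
Unset Strict Implicit.
Unset Printing Implicit Defensive.
Import Order.TTheory GRing.Theory Num.Theory.
Import numFieldNormedType.Exports.
Local Open Scope classical_set_scope.
Local Open Scope ring_scope.

(** The proof combines a reduction to tori with an induction along circle
extensions.

Reduction. For a neighbourhood [U] of 0 in the compact group [G], whether
[g *+ n] lies in [U] is controlled by finitely many frequencies: it is enough that
[n a] be close to 0 modulo 1 for [a] in some finite list of reals
([bohr_neighbourhood]). This follows from Bogolyubov's theorem on differences of
dense sets of integers ([bogolyubov]), a finite Fourier computation. Applied to
the integers [n ^ k], it turns the statement into one on the phases [n ^ k * a]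
modulo 1 ([torus_phases]). A basis of the rational span of 1 and the numbers [a]
([free_mod1_basis]), together with the replacement of [T] by a power that clears
denominators ([universal_power]), reduces to numbers [a] that are independent
from each other and from 1 over the rationals.

Tower. In terms of binomial coefficients instead of powers, the phases are the
coordinates of a tower of circle extensions [(z, h) |-> (S z, h + phi z)], where
[phi] is either a constant or a previous coordinate. Every point above [Y] has a
dense orbit in the tower ([tower_universal]), by induction on its height. Indeed, let
[S] satisfy this at some height. The closure of the orbit of a point in the next
extension meets its own fibre in a closed subgroup of the circle. If this is the
whole circle for each point, the extension also has the property; otherwise there
are [m > 0] and a continuous circle-valued [f] with [f (S z) = f z + m phi z]
([extension_dichotomy]).

Contradiction. Real functions that grow by a nonzero constant along [S] do
not exist, because universal points are recurrent ([no_drift]). When [phi] is a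
coordinate, the variation of [f] along a full turn of this coordinate is such a function
([tower_step_high]). When [phi] is constant, [f] restricts to a circle-valued function on
[Y] that grows by a constant along [T]; simple connectedness of [Y] lifts it to
a real function ([simply_connected_lift]), and the constant must be an integer
([rotation_number]), which is a rational relation between the frequencies
([tower_step_low]). *)

(** * Reals modulo 1 *)

(** Closeness modulo 1. Quantifying over the nearest integer instead of defining
the distance makes the triangle inequality immediate. *)
Definition cball (R : realType) (x e y : R) : Prop :=
  exists2 k : R, k \is a Num.int & `|x - y - k| < e.

(** The circle R/Z, presented as the reals with the pseudometric of the distance
modulo 1. Its points are real representatives, so that lifting a map to R
amounts to changing the topology of the target, and a map into [circ R] is only
meaningful up to integers. *)
Definition circ (R : realType) : Type := R.

Section Circle.
Variable R : realType.
Implicit Types x y z e : R.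

Lemma cball_center x e : 0 < e -> cball x e x.
Proof. by move=> e0; exists 0; rewrite ?rpred0// subrr subr0 normr0. Qed.

Lemma cball_sym x y e : cball x e y -> cball y e x.
Proof.
move=> [k kZ kE]; exists (- k); rewrite ?rpredN//.
by rewrite -normrN; have -> : - (y - x - - k) = x - y - k by ring.
Qed.

Lemma cball_triangle x y z e1 e2 :
  cball x e1 y -> cball y e2 z -> cball x (e1 + e2) z.
Proof.
move=> [k kZ kE] [l lZ lE]; exists (k + l); rewrite ?rpredD//.
have -> : x - z - (k + l) = (x - y - k) + (y - z - l) by ring.
by rewrite (le_lt_trans (ler_normD _ _))// ltrD.
Qed.

HB.instance Definition _ := Choice.on (circ R).
HB.instance Definition _ := hasNbhs.Build (circ R)
  (nbhs_ball_ (@cball R : circ R -> R -> circ R -> Prop)).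
Let circ_nbhsE :
  nbhs = nbhs_ (entourage_ (@cball R : circ R -> R -> circ R -> Prop)).
Proof.
rewrite predeq2E => x P; split => [[e e0 eP]|[B [e e0 eB] BP]].
  exists [set xy | cball xy.1 e xy.2]; first by exists e.
  by move=> y /xsectionP /eP.
by exists e => // y xy; apply/BP/xsectionP/eB.
Qed.

HB.instance Definition _ := Nbhs_isPseudoMetric.Build R (circ R)
  circ_nbhsE cball_center cball_sym cball_triangle erefl.
End Circle.

Section CircleTheory.
Variable R : realType.
Implicit Types x y e k : R.

Lemma int_congr x y : x \is a Num.int -> y = x -> y \is a Num.int.
Proof. by move=> xZ ->. Qed.

Lemma int_lt1_eq0 k : k \is a Num.int -> `|k| < 1 -> k = 0.
Proof.
move=> kZ k1; apply/eqP; apply: contraTT k1 => k0.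
by rewrite -leNgt norm_intr_ge1.
Qed.

Lemma cball_int x y e : 0 < e -> x - y \is a Num.int -> cball x e y.
Proof. by move=> e0 xy; exists (x - y); rewrite ?subrr ?normr0. Qed.

Lemma cball_norm x y e : `|x - y| < e -> cball x e y.
Proof. by move=> xy; exists 0; rewrite ?rpred0 ?subr0. Qed.

Lemma cballD x y x' y' e e' :
  cball x e y -> cball x' e' y' -> cball (x + x') (e + e') (y + y').
Proof.
move=> [k kZ kE] [l lZ lE]; exists (k + l); rewrite ?rpredD//.
have -> : x + x' - (y + y') - (k + l) = (x - y - k) + (x' - y' - l) by ring.
by rewrite (le_lt_trans (ler_normD _ _))// ltrD.
Qed.

Lemma cballN x y e : cball x e y -> cball (- x) e (- y).
Proof.
move=> [k kZ kE]; exists (- k); rewrite ?rpredN//.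
by rewrite -normrN; have -> : - (- x - - y - - k) = x - y - k by ring.
Qed.

Lemma cball0B x y e : cball 0 e (y - x) <-> cball x e y.
Proof. by split=> -[k kZ kE]; exists k => //; move: kE; rewrite sub0r opprB. Qed.

Lemma cball_eq_int x y : (forall e, 0 < e -> cball x e y) -> x - y \is a Num.int.
Proof.
move=> xy; have [k kZ kE] := xy (1/2) ltac:(lra).
have [/eqP|xyk] := eqVneq (x - y - k) 0; first by rewrite subr_eq0 => /eqP ->.
have xyk0 : 0 < `|x - y - k| by rewrite normr_gt0.
have [l lZ lE] := xy _ xyk0.
have /eqP : k - l = 0.
  apply: int_lt1_eq0; first by rewrite rpredB.
  have -> : k - l = (x - y - l) - (x - y - k) by ring.
  by rewrite (le_lt_trans (ler_normB _ _))//; lra.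
by rewrite subr_eq0 => /eqP kl; move: lE; rewrite -kl ltxx.
Qed.

Lemma circ_cvgP (Z : Type) (F : set_system Z) (FF : Filter F)
  (f : Z -> R) (a : R) :
  (f : Z -> circ R) @ F --> (a : circ R) <->
  forall e, 0 < e -> \forall z \near F, cball a e (f z).
Proof. exact: cvg_ballP. Qed.

Lemma circ_cvg (Z : Type) (F : set_system Z) (FF : Filter F)
  (f : Z -> R) (a : R) : f @ F --> a -> (f : Z -> circ R) @ F --> (a : circ R).
Proof.
move=> /cvgrPdist_lt fa; apply/circ_cvgP => e /fa.
by apply: filterS => z; exact: cball_norm.
Qed.

Lemma circ_cvgD (Z : Type) (F : set_system Z) (FF : Filter F)
  (f g : Z -> R) (a b : R) :
  (f : Z -> circ R) @ F --> (a : circ R) ->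
  (g : Z -> circ R) @ F --> (b : circ R) ->
  ((fun z => f z + g z) : Z -> circ R) @ F --> (a + b : circ R).
Proof.
move=> /circ_cvgP fa /circ_cvgP gb; apply/circ_cvgP => e e0.
have e2 : 0 < e / 2 by rewrite divr_gt0.
near=> z; rewrite (splitr e); apply: cballD.
  by near: z; exact: fa.
by near: z; exact: gb.
Unshelve. all: by end_near. Qed.

Lemma circ_cvgN (Z : Type) (F : set_system Z) (FF : Filter F)
  (f : Z -> R) (a : R) :
  (f : Z -> circ R) @ F --> (a : circ R) ->
  ((fun z => - f z) : Z -> circ R) @ F --> (- a : circ R).
Proof.
move=> /circ_cvgP fa; apply/circ_cvgP => e /fa.
by apply: filterS => z; exact: cballN.
Qed.

Lemma circ_cvgB (Z : Type) (F : set_system Z) (FF : Filter F)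
  (f g : Z -> R) (a b : R) :
  (f : Z -> circ R) @ F --> (a : circ R) ->
  (g : Z -> circ R) @ F --> (b : circ R) ->
  ((fun z => f z - g z) : Z -> circ R) @ F --> (a - b : circ R).
Proof. by move=> fa gb; apply: circ_cvgD => //; exact: circ_cvgN. Qed.

Lemma cvg_pairt (T : Type) (U V : topologicalType) (F : set_system T)
  (FF : Filter F) (f : T -> U) (g : T -> V) (a : U) (b : V) :
  f @ F --> a -> g @ F --> b -> (fun t => (f t, g t)) @ F --> (a, b).
Proof. exact: cvg_pair. Qed.

(** The representative of [x] modulo 1 in [-1/2, 1/2[. *)
Definition pv x : R := x - (Num.floor (x + 1 / 2))%:~R.

Lemma pv_int x : pv x - x \is a Num.int.
Proof. by rewrite /pv addrC addKr rpredN intr_int. Qed.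

Lemma pvE x k : k \is a Num.int -> `|x - k| < 1/2 -> pv x = x - k.
Proof.
move=> kZ; rewrite ltr_norml => /andP[k1 k2]; rewrite /pv.
have /andP[f1 f2] := floor_itv (x + 1 / 2); rewrite intrD in f2.
have /eqP : k - (Num.floor (x + 1 / 2))%:~R = 0.
  apply: int_lt1_eq0; first by rewrite rpredB// intr_int.
  by rewrite ltr_norml; apply/andP; split; lra.
by rewrite subr_eq0 => /eqP <-.
Qed.

(** [pv] jumps only at the class of 1/2, which a bound 1/4 on the distance to
0 keeps away. *)
Lemma pv_cvg (Z : Type) (F : set_system Z) (FF : Filter F)
  (f : Z -> R) (a : R) : cball 0 (1 / 4) a ->
  (f : Z -> circ R) @ F --> (a : circ R) -> pv \o f @ F --> pv a.
Proof.
move=> [k kZ ak] /circ_cvgP fa; apply/cvgrPdist_lt => e e0.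
have e4 : 0 < Num.min e (1 / 4) by rewrite lt_min e0; apply/andP; split=> //; lra.
near=> z; have [l lZ] : cball a (Num.min e (1/4)) (f z) by near: z; exact: fa.
rewrite lt_min => /andP[le l4] /=.
rewrite (@pvE a (- k)) ?rpredN//; last first.
  by rewrite (_ : a - - k = - (0 - a - k)); [rewrite normrN; lra|ring].
rewrite (@pvE (f z) (- k - l)) ?rpredB ?rpredN//.
  by have -> : a - - k - (f z - (- k - l)) = a - f z - l by ring.
have -> : f z - (- k - l) = - ((a - f z - l) + (0 - a - k)) by ring.
by rewrite normrN (le_lt_trans (ler_normD _ _))//; lra.
Unshelve. all: by end_near. Qed.

Lemma continuous_int_cst (h : R -> R) :
  continuous h -> (forall t, h t \is a Num.int) -> forall t t', h t = h t'.
Proof.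
move=> hc hZ.
suff H (t t' : R) : t <= t' -> h t = h t'.
  by move=> t t'; have [/H//|/ltW/H] := leP t t'.
move=> tt'; apply/eqP; apply/negPn/negP => hne.
pose v := Num.min (h t) (h t') + 1 / 2.
have dne : 1 <= `|h t - h t'| by rewrite norm_intr_ge1 ?rpredB// subr_eq0.
have vb : Num.min (h t) (h t') <= v <= Num.max (h t) (h t').
  rewrite /v; case: (leP (h t) (h t')) dne => hh; rewrite ler_normr;
    move=> /orP[]; lra.
have [c _ hcv] := IVT tt' (continuous_subspaceT hc) vb.
have /eqP : 1/2 = 0 :> R.
  apply: int_lt1_eq0; last by rewrite ger0_norm; lra.
  have -> : 1/2 = h c - Num.min (h t) (h t') by rewrite hcv /v; ring.
  by rewrite rpredB//; case: (leP (h t) (h t')).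
by lra.
Qed.

Definition clamp x : R := Num.max 0 (Num.min 1 x).

Lemma clamp_itv x : 0 <= clamp x <= 1.
Proof. by rewrite /clamp le_max lexx ge_max ler01 ge_min lexx. Qed.

Lemma clamp_id x : 0 <= x <= 1 -> clamp x = x.
Proof. by rewrite /clamp => /andP[x0 x1]; rewrite min_r// max_r. Qed.

Lemma clampP x : [\/ x <= 0 /\ clamp x = 0, 0 <= x <= 1 /\ clamp x = x
  | 1 <= x /\ clamp x = 1].
Proof.
have [x0|x0] := leP x 0.
  by apply: Or31; split => //; rewrite /clamp min_r ?max_l//; lra.
have [x1|x1] := leP x 1.
  by apply: Or32; rewrite clamp_id ?x1 ?ltW.
by apply: Or33; rewrite ltW// /clamp min_l ?max_r//; lra.
Qed.

Lemma clamp_lipschitz x y : `|clamp x - clamp y| <= `|x - y|.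
Proof.
rewrite ler_norml; have := ler_norm (x - y); have := ler_norm (y - x).
rewrite distrC => h1 h2.
by case: (clampP x) => -[? ->]; case: (clampP y) => -[? ->];
  have := normr_ge0 (x - y); move=> *; apply/andP; split; lra.
Qed.

Lemma clamp_continuous : continuous clamp.
Proof.
move=> x; apply/cvgrPdist_lt => e e0; near=> y.
apply: le_lt_trans (clamp_lipschitz _ _) _.
by near: y; exact: (nbhsx_ballx x e e0).
Unshelve. all: by end_near. Qed.

(** Two lifts of a path differ by a continuous integer-valued function, which is
constant. *)
Lemma lift_unique (g g' : R -> R) : continuous g -> continuous g' ->
  g 0 = g' 0 -> (forall t, 0 <= t <= 1 -> g t - g' t \is a Num.int) ->
  forall t, 0 <= t <= 1 -> g t = g' t.
Proof.
move=> gc gc' g0 gZ t t01.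
have := @continuous_int_cst (fun t => g (clamp t) - g' (clamp t)) _ _ t 0.
rewrite !(@clamp_id 0) ?lexx ?ler01// g0 subrr clamp_id// => H.
apply/eqP; rewrite -subr_eq0; apply/eqP/H => [s|s]; last exact/gZ/clamp_itv.
by apply: cvgB; [apply: (@continuous_comp _ _ _ (@clamp) g)|
  apply: (@continuous_comp _ _ _ (@clamp) g')]; try exact: clamp_continuous;
  [exact: gc|exact: gc'].
Qed.

End CircleTheory.

(** * Lifting circle-valued maps *)

Section FibreLift.
Variables (R : realType) (Z : topologicalType) (F : Z -> R -> R).
Hypothesis Fc : continuous ((fun p => F p.1 p.2) : Z * R -> circ R).

(** Subdividing the interval in [N.+1] parts is enough for the lift over [z]. *)
Let fine (N : nat) (z : Z) : Prop :=
  forall t t' : R, 0 <= t <= 1 -> 0 <= t' <= 1 -> `|t - t'| <= N.+1%:R^-1 ->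
    cball (F z t) (1/4) (F z t').

Let fine_near (z : Z) : exists N, \forall z' \near z, fine N z'.
Proof.
have /compact_near_coveringP cov := @segment_compact R 0 1.
pose G := filter_prod (nbhs z) (nbhs \oo).
pose P (i : Z * nat) (t : R) := forall t', `|t - t'| <= i.2.+1%:R^-1 ->
  cball (F i.1 t) (1/4) (F i.1 t').
have [|[W V] /= [Wz [N _ NV]] WP] := cov _ G P _.
  move=> t _.
  have e8 : 0 < 1/8 :> R by lra.
  have [[W V]/= [Wz /nbhs_ballP[r /= r0 rV]] WV] :=
    proj1 (circ_cvgP _ _ _) (@Fc (z, t)) _ e8.
  have r2 : 0 < r / 2 by lra.
  exists (ball t (r/2), (W `*` [set N : nat | N.+1%:R^-1 < r / 2])) => /=.
    split; first exact: nbhsx_ballx.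
    exists (W, [set N : nat | N.+1%:R^-1 < r / 2]) => //=; split => //=.
    near=> N => /=; near: N; exact: near_infty_natSinv_lt (PosNum r2).
  move=> [t1 [z1 N]] /= [] t1r [Wz1 Nr] t2 /= t12.
  have -> : 1 / 4 = 1 / 8 + 1 / 8 :> R by lra.
  apply: (@cball_triangle _ _ (F z t)).
    apply: cball_sym; apply: (WV (z1, t1)); split => //=.
    by apply: rV; apply: le_ball t1r; lra.
  apply: (WV (z1, t2)); split => //=.
  apply: rV; rewrite /ball/= (_ : t - t2 = (t - t1) + (t1 - t2)); last by ring.
  rewrite (splitr r) (le_lt_trans (ler_normD _ _))// ltrD//.
  exact: le_lt_trans t12 _.
exists N; apply: filterS Wz => z' Wz' t t' t01 t01' tt'.
by apply: (WP (z', N) (conj Wz' (NV N (leqnn N)))) => //=; rewrite in_itv.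
Unshelve. all: by end_near. Qed.

Let inc N (i : nat) (z : Z) (t : R) : R :=
  F z (clamp t * i.+1%:R / N.+1%:R) - F z (clamp t * i%:R / N.+1%:R).

Let dl N (z : Z) (t : R) : R := \sum_(i < N.+1) pv (inc N i z t).

Let sub_itv N i (t : R) : (i <= N.+1)%N -> 0 <= clamp t * i%:R / N.+1%:R <= 1.
Proof.
move=> iN; have /andP[t0 t1] := clamp_itv t.
rewrite divr_ge0 ?mulr_ge0//= ler_pdivrMr ?ltr0n// mul1r.
by rewrite (le_trans (ler_piMl _ t1))// ler_nat.
Qed.

Let fine_inc N z i t : fine N z -> (i < N.+1)%N -> cball 0 (1/4) (inc N i z t).
Proof.
move=> fN iN; apply/cball0B; apply: fN; [exact/sub_itv/ltnW|exact: sub_itv|].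
have /andP[t0 t1] := clamp_itv t.
rewrite -[i.+1%:R]natr1 mulrDr mulr1 mulrDl opprD addrA subrr sub0r normrN.
by rewrite ger0_norm ?divr_ge0// ler_piMl// invr_ge0.
Qed.

Let dl0 N z : dl N z 0 = 0.
Proof.
rewrite /dl big1// => i _; rewrite /inc clamp_id ?lexx ?ler01// !mul0r subrr.
by rewrite (@pvE _ 0 0) ?rpred0 ?subr0 ?normr0//; lra.
Qed.

Let dl_int N z t : 0 <= t <= 1 -> dl N z t - (F z t - F z 0) \is a Num.int.
Proof.
move=> t01; have -> : F z t - F z 0 = \sum_(i < N.+1) inc N i z t.
  rewrite /inc -(big_mkord predT (fun i => F z (clamp t * i.+1%:R / N.+1%:R)
    - F z (clamp t * i%:R / N.+1%:R))) telescope_sumr//.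
  by rewrite mulr0 mul0r mulfK ?pnatr_eq0// clamp_id.
by rewrite -sumrB rpred_sum// => i _; exact: pv_int.
Qed.

Let inc_continuous N i : continuous ((fun p => inc N i p.1 p.2) : Z * R -> circ R).
Proof.
have aux (j : nat) : continuous
    ((fun p => F p.1 (clamp p.2 * j%:R / N.+1%:R)) : Z * R -> circ R).
  move=> p; apply: (@continuous_comp _ _ _
    (fun p : Z * R => (p.1, clamp p.2 * j%:R / N.+1%:R))
    ((fun p => F p.1 p.2) : Z * R -> circ R)); last exact: Fc.
  apply: cvg_pairt; first exact: cvg_fst.
  apply: cvgM; last exact: cvg_cst.
  apply: cvgM; last exact: cvg_cst.
  apply: (@continuous_comp _ _ _ snd (@clamp R)); first exact: cvg_snd.
  exact: clamp_continuous.
by move=> p; apply: circ_cvgB; exact: aux.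
Qed.

Let dl_continuous N z t : fine N z ->
  {for (z, t), continuous (fun p : Z * R => dl N p.1 p.2)}.
Proof.
move=> fN; apply: cvg_big => [|i _]; first exact: add_continuous.
apply: (@pv_cvg _ _ _ _ (fun p : Z * R => inc N i p.1 p.2)).
  exact: fine_inc.
exact: (@inc_continuous N i (z, t)).
Qed.

(** A circle-valued map lifts along the unit interval, continuously in the
parameter [z]: near [z], compactness of the interval gives one subdivision on
which [F] moves by less than 1/4 at each step, and the lift is the sum of the
small representatives of these increments. By uniqueness of lifts the result
does not depend on the subdivision. *)
Lemma fibre_lift : exists d : Z -> R -> R, [/\ forall z, d z 0 = 0,
  forall z t, 0 <= t <= 1 -> d z t - (F z t - F z 0) \is a Num.int,
  forall z, continuous (d z) &
  forall t, 0 <= t <= 1 -> continuous (d^~ t)].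
Proof.
(* The subdivision is chosen separately for each point; only uniqueness of
   lifts relates the choices made at neighbouring points. *)
have [N NP] := choice fine_near.
have fN z : fine (N z) z by exact: nbhs_singleton (NP z).
have dc M z : fine M z -> continuous (dl M z).
  move=> fM t; apply: (@continuous_comp _ _ _ (pair z) (fun p => dl M p.1 p.2)).
    by apply: cvg_pairt => /=; [exact: cvg_cst|exact: cvg_id].
  exact: dl_continuous.
exists (fun z => dl (N z) z); split => [z|z t t01|z|t t01 z].
- exact: dl0.
- exact: dl_int.
- exact: dc.
suff : dl (N z) x t @[x --> z] --> dl (N z) z t.
  apply: cvg_trans; apply: near_eq_cvg; near=> x.
  have fx : fine (N z) x by near: x; exact: NP.
  apply: lift_unique t01 => //; [exact: dc|exact: dc|by rewrite !dl0|].
  move=> s s01; have := rpredB (dl_int (N z) x s01) (dl_int (N x) x s01).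
  by rewrite (_ : _ - _ = dl (N z) x s - dl (N x) x s); last by ring.
apply: (@continuous_comp _ _ _ (fun x => (x, t)) (fun p => dl (N z) p.1 p.2)).
  by apply: cvg_pairt => /=; [exact: cvg_id|exact: cvg_cst].
exact: dl_continuous.
Unshelve. all: by end_near. Qed.
End FibreLift.

Section PathLift.
Variable R : realType.

Definition glue (T : Type) (f g : R -> T) (t : R) : T :=
  if t <= 1/2 then f (2 * t) else g (2 * t - 1).

Lemma glue0 (T : Type) (f g : R -> T) : glue f g 0 = f 0.
Proof. by rewrite /glue mulr0; case: leP => // h; exfalso; lra. Qed.

Lemma glue1 (T : Type) (f g : R -> T) : glue f g 1 = g 1.
Proof.
by rewrite /glue; case: leP => [|_]; [move=> h; exfalso; lra|congr g; lra].
Qed.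

Lemma continuous_glue (T : topologicalType) (f g : R -> T) :
  continuous f -> continuous g -> f 1 = g 0 ->
  continuous (glue f g).
Proof.
move=> fc gc fg t.
have f2 s : {for s, continuous (fun t : R => f (2 * t))}.
  apply: (@continuous_comp _ _ _ (fun t : R => 2 * t) f); last exact: fc.
  by apply: cvgM; [exact: cvg_cst|exact: cvg_id].
have g2 s : {for s, continuous (fun t : R => g (2 * t - 1))}.
  apply: (@continuous_comp _ _ _ (fun t : R => 2 * t - 1) g); last exact: gc.
  apply: cvgB; last exact: cvg_cst.
  by apply: cvgM; [exact: cvg_cst|exact: cvg_id].
have [t2|t2|t2] := ltgtP t (1/2).
- rewrite /continuous_at /glue (ltW t2).
  apply: cvg_trans (f2 t); apply: near_eq_cvg; near=> s.
  by rewrite /glue ltW//; near: s; exact: lt_nbhsl.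
- rewrite /continuous_at /glue leNgt t2 /=.
  apply: cvg_trans (g2 t); apply: near_eq_cvg; near=> s.
  by rewrite /glue leNgt (_ : _ < s)//; near: s; exact: lt_nbhsr.
rewrite /continuous_at /glue t2 lexx => W /= W2.
have e1 : 2 * (1/2) = 1 :> R by lra.
have e0 : 2 * (1/2) - 1 = 0 :> R by lra.
have W2g : nbhs (g (2 * (1/2) - 1)) W by rewrite e0 -fg -e1.
have fW : \forall s \near (1/2 : R), W (f (2 * s)) by exact: f2.
have gW : \forall s \near (1/2 : R), W (g (2 * s - 1)) by exact: g2.
suff : \forall s \near (1/2 : R), W (if s <= 1/2 then f (2 * s) else g (2 * s - 1)).
  by [].
by near=> s => /=; case: ifP => _; near: s.
Unshelve. all: by end_near. Qed.

(** Extending paths by constants outside the unit interval turns them into maps on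
the whole of R, where gluing and lifting take place. *)
Definition clampU (t : R) : unit_itv R :=
  exist _ (clamp t) (mem_set (clamp_itv t) : clamp t \in [set` `[0, 1]]).

Lemma clampU_continuous : continuous clampU.
Proof.
by apply: continuous_comp_initial; exact: clamp_continuous.
Qed.

Lemma clampU0 : clampU 0 = zero.
Proof. by apply: val_inj; rewrite /= clamp_id ?lexx ?ler01. Qed.

Lemma clampU1 : clampU 1 = one.
Proof. by apply: val_inj; rewrite /= clamp_id ?lexx ?ler01. Qed.

Lemma path_fun (T : topologicalType) (x y : T) :
  inhabited {path unit_itv R from x to y in T} ->
  exists g : R -> T, [/\ continuous g, g 0 = x & g 1 = y].
Proof.
move=> [p]; exists (p \o clampU); split => [t||].
- by apply: continuous_comp; [exact: clampU_continuous|exact: cts_fun].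
- by rewrite /= clampU0 path_zero.
- by rewrite /= clampU1 path_one.
Qed.

(** [d] lifts [f], normalised by [d 0 = 0], on the unit interval. *)
Definition lift_of (f d : R -> R) := [/\ d 0 = 0, continuous d &
  forall t, 0 <= t <= 1 -> d t - (f t - f 0) \is a Num.int].

Lemma path_lift (f : R -> R) : continuous (f : R -> circ R) ->
  exists d, lift_of f d.
Proof.
move=> fc; have [|d [d0 dZ dc _]] := @fibre_lift R R (fun=> f).
  by move=> p; apply: (@continuous_comp (R * R)%type R (circ R) snd (f : R -> circ R));
    [exact: cvg_snd|exact: fc].
by exists (d 0); split; [exact: d0|exact: dc|exact: dZ].
Qed.

Lemma lift_of_unique f d d' : lift_of f d -> lift_of f d' ->
  forall t, 0 <= t <= 1 -> d t = d' t.
Proof.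
move=> [d0 dc dZ] [d0' dc' dZ']; apply: lift_unique => //; first by rewrite d0.
move=> s s01; have := rpredB (dZ s s01) (dZ' s s01).
by rewrite (_ : _ - _ - _ = d s - d' s); last by ring.
Qed.

(** Lift a null homotopy of the loop along the first variable: the total variation of
the lift is an integer depending continuously on the stage of the homotopy, hence
constant, and it is 0 at the constant loop. *)
Lemma loop_lift (Y : topologicalType) (f : Y -> R) (g : R -> Y) (d : R -> R) :
  simply_connected R Y -> continuous (f : Y -> circ R) ->
  continuous g -> g 0 = g 1 -> lift_of (f \o g) d -> d 1 = 0.
Proof.
move=> [_ sc] fc gc g01 dg.
pose x := g 0.
pose gU (s : unit_itv R) := g (set_val s).
have gUc : continuous gU.
  move=> s; apply: (@continuous_comp _ _ _ set_val g); last exact: gc.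
  exact: initial_continuous.
have gU1 : gU one = x by rewrite /x g01.
have [H [Hc Hs0 Hs1 Ht0 Ht1]] := sc x (mk_path gUc (erefl : gU zero = x) gU1).
have H0 s : H (clampU s, zero) = g (clamp s) by rewrite Hs0.
pose F (t s : R) := f (H (clampU s, clampU t)).
have [|e [e0 eZ ec ec']] := @fibre_lift R R F.
  move=> p; apply: (@continuous_comp (R * R)%type (unit_itv R * unit_itv R)%type
    (circ R) (fun p => (clampU p.2, clampU p.1)) (f \o H)).
    apply: cvg_pairt.
      by apply: (@continuous_comp _ _ _ snd clampU);
        [exact: cvg_snd|exact: clampU_continuous].
    by apply: (@continuous_comp _ _ _ fst clampU);
      [exact: cvg_fst|exact: clampU_continuous].
  by apply: (@continuous_comp _ _ (circ R) H f); [exact: Hc|exact: fc].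
have i01 : 0 <= (1 : R) <= 1 by rewrite ler01 lexx.
have e1 t t' : e t 1 = e t' 1.
  apply: (@continuous_int_cst R (e^~ 1)) => [|s]; first exact: ec'.
  have := eZ s 1 i01.
  by rewrite /F clampU0 clampU1 Ht0 Ht1 subrr subr0.
have -> : d 1 = e 0 1.
  apply: (lift_of_unique dg) i01; split; [exact: e0|exact: ec|move=> t t01].
  have := eZ 0 t t01.
  by rewrite /F clampU0 Ht0 H0 clamp_id.
rewrite (e1 0 1); apply: (@lift_unique R (e 1) (cst 0)) i01.
- exact: ec.
- by move=> ?; exact: cvg_cst.
- exact: e0.
move=> t t01; have := eZ 1 t t01.
by rewrite /F clampU1 !Hs1 /= subrr !subr0.
Qed.

Lemma lift_glue (Y : Type) (f : Y -> R) (g k : R -> Y) (d e : R -> R) :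
  lift_of (f \o g) d -> g 1 = k 0 -> continuous e -> e 0 = d 1 ->
  (forall t, 0 <= t <= 1 -> e t - e 0 - (f (k t) - f (k 0)) \is a Num.int) ->
  lift_of (f \o glue g k) (glue d e).
Proof.
move=> [d0 dc dZ] gk ec e0 eZ; split.
- by rewrite glue0.
- exact: continuous_glue.
move=> t /andP[t0 t1] /=; rewrite glue0 /glue; case: leP => t2.
  by apply: dZ; apply/andP; split; lra.
have i01 : 0 <= (1 : R) <= 1 by rewrite ler01 lexx.
have h : 0 <= 2 * t - 1 <= 1 by apply/andP; split; lra.
have := rpredD (dZ 1 i01) (eZ _ h); rewrite /= gk e0.
move: (e _) (f (k _)) (f (k 0)) (f (g 0)) => a b c c'.
by rewrite (_ : d 1 - _ + _ = a - (b - c')); last by ring.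
Qed.

(** Follow one path, then the other one backwards, and apply [loop_lift]. *)
Lemma same_ends_lift (Y : topologicalType) (f : Y -> R) (g g' d d' : R -> _) :
  simply_connected R Y -> continuous (f : Y -> circ R) ->
  continuous g -> continuous g' -> g 0 = g' 0 :> Y -> g 1 = g' 1 ->
  lift_of (f \o g) d -> lift_of (f \o g') d' -> d 1 = d' 1.
Proof.
move=> sc fc gc gc' g0 g1 [d0 dc dZ] [d0' dc' dZ'].
pose r (t : R) : R := 1 - t.
have rc : continuous r by move=> t; apply: cvgB; [exact: cvg_cst|exact: cvg_id].
pose e (t : R) := d 1 + (d' (1 - t) - d' 1).
have ec : continuous e.
  move=> t; apply: cvgD; first exact: cvg_cst.
  apply: cvgB; last exact: cvg_cst.
  by apply: (@continuous_comp _ _ _ r d'); [exact: rc|exact: dc'].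
have hc : continuous (g' \o r).
  by move=> t; apply: continuous_comp; [exact: rc|exact: gc'].
have i01 : 0 <= (1 : R) <= 1 by rewrite ler01 lexx.
have gr : g 1 = (g' \o r) 0 by rewrite /= /r subr0.
have dl : lift_of (f \o glue g (g' \o r)) (glue d e).
  apply: lift_glue => //; first by rewrite /e subr0 subrr addr0.
  move=> t t01; have h : 0 <= 1 - t <= 1 by lra.
  by apply: int_congr (rpredB (dZ' _ h) (dZ' 1 i01)) _; rewrite /= /e /r subr0; ring.
have := loop_lift sc fc (continuous_glue gc hc gr) _ dl.
rewrite glue0 !glue1 /= /e /r subrr d0' => /(_ g0); lra.
Qed.

(** The lift at [y] is the variation of [f] along any path from a base point to [y].
It is continuous because [y] has arbitrarily small path connected neighbourhoods,
inside which the variation of [f] is its small representative [pv]. *)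
Lemma simply_connected_lift (Y : topologicalType) (f : Y -> R) :
  locally_path_connected R Y -> simply_connected R Y ->
  continuous (f : Y -> circ R) ->
  exists2 h : Y -> R, continuous h & forall y, h y - f y \is a Num.int.
Proof.
move=> lpc sc fc; have [[[y0 _] pc] _] := sc.
have fgc (g : R -> Y) : continuous g -> continuous (f \o g : R -> circ R).
  by move=> gc t; apply: (@continuous_comp _ _ (circ R) g f); [exact: gc|exact: fc].
have /choice[v vP] (y : Y) : exists v : R, exists (g : R -> Y) (d : R -> R),
    [/\ continuous g, g 0 = y0, g 1 = y,
    lift_of (f \o g) d & d 1 = v].
  have [g [gc g0 g1]] := path_fun (pc y0 y).
  by have [d dP] := path_lift (fgc _ gc); exists (d 1), g, d.
have vE y (g : R -> Y) (d : R -> R) : continuous g -> g 0 = y0 -> g 1 = y ->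
    lift_of (f \o g) d -> d 1 = v y.
  move=> gc g0 g1 dg; have [g' [d' [gc' g0' g1' dg' <-]]] := vP y.
  by apply: (same_ends_lift sc fc gc gc' _ _ dg dg'); rewrite ?g0 ?g0'// g1 g1'.
have i01 : 0 <= (1 : R) <= 1 by rewrite ler01 lexx.
exists (fun y => v y + f y0) => [y|y]; last first.
  have [g [d [gc g0 g1 [_ _ dZ] <-]]] := vP y.
  by have := dZ 1 i01; rewrite /= g0 g1 opprB addrA.
have e4 : 0 < 1 / 4 :> R by lra.
have Uy : nbhs y [set y' | cball (f y) (1/4) (f y')].
  exact: (proj1 (circ_cvgP _ _ _) (fc y) _ e4).
have [V [[Vo Vy] VU Vpc]] := lpc y _ Uy.
have Vv y' : V y' -> v y' = v y + pv (f y' - f y).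
  move=> Vy'; have [_ VP] := Vpc.
  have [s [sc0 s0 s1]] :=
    path_fun (VP (exist _ y (mem_set Vy)) (exist _ y' (mem_set Vy'))).
  pose k t := set_val (s t) : Y.
  have kc : continuous k.
    move=> t; apply: (@continuous_comp _ _ _ s set_val); first exact: sc0.
    exact: initial_continuous.
  have k0 : k 0 = y by rewrite /k s0.
  have k1 : k 1 = y' by rewrite /k s1.
  have kV t : V (k t) by rewrite /k; exact: set_valP.
  have [g [d [gc g0 g1 [d0 dc dZ] <-]]] := vP y.
  pose e t := d 1 + pv (f (k t) - f y).
  have pv0 : pv (f y - f y) = 0.
    by rewrite subrr (@pvE _ 0 0) ?rpred0 ?subr0 ?normr0//; lra.
  have ec : continuous e.
    move=> t; apply: cvgD; first exact: cvg_cst.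
    apply: (@pv_cvg _ _ _ _ (fun t => f (k t) - f y)).
      by apply/cball0B; exact: VU.
    apply: circ_cvgB; last exact: cvg_cst.
    by apply: fgc.
  have ed : d 1 = e 0 by rewrite /e k0 pv0 addr0.
  have gk : g 1 = k 0 by rewrite g1 k0.
  have dg : lift_of (f \o glue g k) (glue d e).
    apply: lift_glue => // t t01.
    have := pv_int (f (k t) - f y); rewrite -ed k0 /e.
    move: (pv _) => a.
    by rewrite (_ : d 1 + a - d 1 = a); last by ring.
  have := vE y' _ _ (continuous_glue gc kc gk) _ _ dg.
  by rewrite glue0 !glue1 /e k1 => /(_ g0 erefl) <-.
apply: cvgD; last exact: cvg_cst.
suff : (fun y' => v y + pv (f y' - f y)) @ y --> v y.
  apply: cvg_trans; apply: near_eq_cvg; near=> y'; rewrite (Vv y')//.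
    by near: y'; apply: open_nbhs_nbhs; split.
rewrite -[X in _ --> X]addr0; apply: cvgD; first exact: cvg_cst.
have -> : 0 = pv (f y - f y) :> R.
  by rewrite subrr (@pvE _ 0 0) ?rpred0 ?subr0 ?normr0//; lra.
apply: (@pv_cvg _ _ _ _ (fun y' => f y' - f y)).
  by apply/cball0B; apply: cball_norm; rewrite subrr normr0; lra.
by apply: circ_cvgB; [exact: fc|exact: cvg_cst].
Unshelve. all: by end_near. Qed.

End PathLift.

(** * Universal points and circle extensions *)

Lemma cball_intr (R : realType) (x y y' e : R) :
  y - y' \is a Num.int -> cball x e y -> cball x e y'.
Proof.
move=> yy' [k kZ kE]; exists (k + (y - y')); first by rewrite rpredD.
by rewrite (_ : x - y' - _ = x - y - k)//; ring.
Qed.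

Lemma int_subC (R : realType) (x y : R) :
  x - y \is a Num.int -> y - x \is a Num.int.
Proof. by rewrite -opprB rpredN. Qed.

(** Let [a] be the infimum of the positive elements. If [a = 0], multiples of small
elements are dense. Otherwise [a] belongs to [H], and the first multiple of [a]
exceeding 1 forces [1/a] to be an integer [m]; then [-a] is a multiple of [a]
modulo 1, so that [H] is a group. *)
Lemma closed_subsemigroup_circle (R : realType) (H : set R) :
  H !=set0 -> (forall h k, H h -> H k -> H (h + k)) ->
  (forall h k, H h -> k \is a Num.int -> H (h + k)) ->
  (forall h, (forall e, 0 < e -> exists2 k, H k & `|h - k| < e) -> H h) ->
  H = setT \/ exists2 m : nat, (0 < m)%N & forall h, H h <-> m%:R * h \is a Num.int.
Proof.
move=> [h0 Hh0] HD HZ Hcl.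
have Hn n h : H h -> H (n.+1%:R * h).
  move=> Hh; elim: n => [|n IH]; first by rewrite mul1r.
  by rewrite -natr1 mulrDl mul1r; exact: HD.
have [small|/existsNP[e0 /not_implyP[e0pos noH]]] :=
    pselect (forall e, 0 < e -> exists2 h, H h & 0 < h < e).
  left; rewrite -subTset => x _; apply: Hcl => e /small [h Hh /andP[h0' he]].
  pose N : R := (Num.floor (x - h))%:~R.
  have NZ : N \is a Num.int by exact: intr_int.
  have yh : h <= x - N by have := floor_le (x - h); rewrite -/N; lra.
  have y0 : 0 <= (x - N) / h by rewrite divr_ge0//; lra.
  have := truncn_itv y0.
  case: (Num.truncn _) => [|n].
    by rewrite ltr_pdivrMr// => /andP[_]; lra.
  rewrite ler_pdivlMr// ltr_pdivrMr// => /andP[n1 n2].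
  exists (n.+1%:R * h + N); first by apply: HZ => //; exact: Hn.
  rewrite ltr_norml; move: n2; rewrite -[n.+2%:R]natr1 mulrDl => n2.
  by apply/andP; split; lra.
right; pose A := [set h | H h /\ 0 < h].
have Age h : H h -> 0 < h -> e0 <= h.
  move=> Hh hp; rewrite leNgt; apply/negP => he; apply: noH.
  by exists h => //; rewrite hp.
have Ai : has_inf A.
  split; last by exists 0 => h [_ /ltW].
  exists (h0 - (Num.floor h0)%:~R + 1); split.
    by rewrite -addrA; apply: HZ => //; rewrite rpredD ?rpredN ?intr_int ?rpred1.
  by have := floor_le h0; lra.
pose a := inf A.
have a0 : 0 < a.
  apply: lt_le_trans e0pos _; apply: lb_le_inf; first by case: Ai.
  by move=> h [Hh hp]; exact: Age.
have amin h : H h -> 0 < h -> a <= h.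
  by move=> Hh hp; apply: ge_inf => //; case: Ai.
have Ha : H a.
  apply: Hcl => e ep; have [h [Hh hp] hae] := inf_adherent ep Ai.
  exists h => //; rewrite -/a in hae; have := amin h Hh hp.
  by move=> ?; rewrite ltr_norml; apply/andP; split; lra.
have ia0 : 0 <= a^-1 by rewrite invr_ge0 ltW.
have := truncn_itv ia0; set m := Num.truncn _.
rewrite -[a^-1]mul1r ler_pdivlMr// ltr_pdivrMr// => /andP[m1 m2].
have ma : m%:R * a = 1.
  (* This element lies in ]0, a], so that minimality makes it equal to a. *)
  have Hb : H (m.+1%:R * a - 1) by apply: HZ; [exact: Hn|rewrite rpredN rpred1].
  have := amin _ Hb; move: m2; rewrite -natr1 mulrDl mul1r => m2.
  by move=> /(_ ltac:(lra)) ?; lra.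
have m0 : (0 < m)%N.
  by rewrite lt0n; apply/eqP => m0; move: ma; rewrite m0 mul0r; lra.
have Hq (q : int) : H (q%:~R * a).
  (* Since [m a = 1], adding a multiple of [m] to [q] does not change [q a] modulo 1
     and makes the coefficient positive. *)
  have [n nE] : exists n : nat, q + (m * (`|q|.+1))%N%:Z = n.+1%:Z.
    have : 0 < q + (m * `|q|.+1)%N%:Z.
      rewrite -subr_gt0 subr0; apply: (@lt_le_trans _ _ (q + `|q|.+1%:Z)).
        by case: (q) => k //=; lia.
      by rewrite lerD2l lez_nat leq_pmull.
    by case: (_ + _) => // -[|n] // _; exists n.
  have -> : q%:~R * a = n.+1%:R * a - `|q|.+1%:R.
    have : (q + (m * (`|q|.+1))%N%:Z)%:~R = n.+1%:Z%:~R :> R by rewrite nE.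
    rewrite intrD -!pmulrn natrM => <-.
    by rewrite mulrDl mulrAC ma; ring.
  by apply: HZ; [exact: Hn|rewrite rpredN rpred_nat].
exists m => // h; split => [Hh|].
  have /andP[q1 q2] := floor_itv (m%:R * h).
  move: q1 q2; set q := Num.floor _ => q1 q2.
  have Hb : H (h + (- q)%:~R * a) by exact: HD.
  have mb : m%:R * (h + (- q)%:~R * a) = m%:R * h - q%:~R.
    by rewrite mulrDr mulrCA ma mulr1 rmorphN.
  have mR : 0 < m%:R :> R by rewrite ltr0n.
  have b0 : 0 <= h + (- q)%:~R * a by rewrite -(pmulr_rge0 _ mR) mb subr_ge0.
  have ba : h + (- q)%:~R * a < a.
    by rewrite -(ltr_pM2l mR) mb ma ltrBlDl -(intrD _ _ 1).
  have b00 : h + (- q)%:~R * a = 0.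
    apply/eqP; rewrite eq_le b0 andbT leNgt; apply/negP => /(amin _ Hb).
    by rewrite leNgt ba.
  move: mb; rewrite b00 mulr0 => /esym/eqP; rewrite subr_eq0 => /eqP ->.
  exact: intr_int.
move=> /intrP[q qE]; have -> : h = q%:~R * a by rewrite -qE mulrAC ma mul1r.
exact: Hq.
Qed.

(** Explicit injection into the subtype of a set, in which the membership proof
is provided. *)
Definition to_sub (Z : Type) (A : set Z) (z : Z) (Az : A z) : A :=
  exist (fun z => z \in A) z (mem_set Az).

Lemma displacement_continuous (R : realType) (T : topologicalType)
  (h : T -> R) (u : T -> T) (c : R) : continuous h -> continuous u ->
  continuous (fun t => h (u t) - h t - c).
Proof.
move=> hc uc t; apply: cvgB; last exact: cvg_cst.
apply: cvgB; last exact: hc.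
by apply: (@continuous_comp _ _ _ u h); [exact: uc|exact: hc].
Qed.

Section Dynamics.
Variables (R : realType) (Z : topologicalType) (S : Z -> Z).
Hypothesis Sc : continuous S.
Implicit Types z : Z.

Lemma iter_continuous n : continuous (iter n S).
Proof.
elim: n => [|n IH] z; first exact: cvg_id.
by apply: (@continuous_comp _ _ _ (iter n S) S); [exact: IH|exact: Sc].
Qed.

Lemma universal_hit z z' (W : set Z) : universal S z -> nbhs z' W ->
  exists2 n, (1 <= n)%N & W (iter n S z).
Proof.
move=> Uz; rewrite nbhsE => -[U [Uo Uz'] UW].
have [w [Uw [n n1 wE]]] := Uz U (ex_intro _ z' Uz') Uo.
by exists n => //; apply: UW; rewrite -wE.
Qed.

Lemma invariant_iter (Y : set Z) n z : S @` Y `<=` Y -> Y z -> Y (iter n S z).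
Proof. by move=> SY Yz; elim: n => //= n IH; apply: SY; exists (iter n S z). Qed.

Section Extension.
Variable phi : Z -> R.
Hypothesis phic : continuous (phi : Z -> circ R).

(** The fibre coordinate of the [n]-th iterate of the circle extension
[(z, h) |-> (S z, h + phi z)] of [S], started at [(z, 0)]. *)
Definition birkhoff n z : R := \sum_(i < n) phi (iter i S z).

Lemma birkhoffD m n z : birkhoff (m + n) z = birkhoff m z + birkhoff n (iter m S z).
Proof.
rewrite /birkhoff big_split_ord /=; congr (_ + _); apply: eq_bigr => i _.
by rewrite addnC iterD.
Qed.

Lemma birkhoff_continuous n : continuous (birkhoff n : Z -> circ R).
Proof.
elim: n => [|n IH] z.
  rewrite /continuous_at /birkhoff big_ord0.
  by under eq_fun do rewrite big_ord0; exact: cvg_cst.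
rewrite /continuous_at /birkhoff big_ord_recr /=.
under eq_fun do rewrite big_ord_recr /=.
apply: circ_cvgD; first exact: IH.
by apply: (@continuous_comp _ _ (circ R) (iter n S) phi);
  [exact: iter_continuous|exact: phic].
Qed.

(** The point [(z', h)] lies in the closure of the forward orbit of [(z, 0)] under
the circle extension. Rotations of the fibre commute with the extension, hence
[(z', h)] may also be read as a displacement of fibres from [z] to [z']. *)
Definition reach z z' h := forall (W : set Z) e, nbhs z' W -> 0 < e ->
  exists n, [/\ (1 <= n)%N, W (iter n S z) & cball h e (birkhoff n z)].

Lemma reach_iter n z : (0 < n)%N -> reach z (iter n S z) (birkhoff n z).
Proof.
move=> n0 W e Wz e0; exists n; split => //; first exact: nbhs_singleton.
exact: cball_center.
Qed.

Lemma reach1 z : reach z (S z) (phi z).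
Proof. by have := @reach_iter 1 z isT; rewrite /birkhoff big_ord1. Qed.

Lemma reach_int z z' h h' : h - h' \is a Num.int -> reach z z' h -> reach z z' h'.
Proof.
move=> hh' zz' W e Wz' e0; have [n [n1 nW nh]] := zz' W e Wz' e0.
by exists n; split => //; apply: cball_sym; apply: cball_intr hh' (cball_sym nh).
Qed.

Lemma reach_trans z z' z'' h h' : reach z z' h -> reach z' z'' h' ->
  reach z z'' (h + h').
Proof.
move=> zz' zz'' W e Wz'' e0.
have e3 : 0 < e / 3 by rewrite divr_gt0.
have [n [n1 nW nh]] := zz'' W° (e / 3) (nbhs_interior Wz'') e3.
have Vz' : nbhs z' (iter n S @^-1` W `&`
    [set w | cball (birkhoff n z') (e / 3) (birkhoff n w)]).
  apply: filterI; first exact: iter_continuous nW.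
  exact: (proj1 (circ_cvgP _ _ _) (@birkhoff_continuous n z')).
have [m [m1 [mW mb] mh]] := zz' _ (e / 3) Vz' e3.
exists (m + n)%N; split; first by rewrite ltn_addr.
  by rewrite addnC iterD.
rewrite birkhoffD (_ : e = e / 3 + (e / 3 + e / 3)); last by field.
by apply: cballD mh _; exact: cball_triangle nh mb.
Qed.

Lemma reach_closed z z' h : (forall W e, nbhs z' W -> 0 < e ->
  exists z1 h1, [/\ W z1, cball h e h1 & reach z z1 h1]) -> reach z z' h.
Proof.
move=> cl W e Wz' e0; have e2 : 0 < e / 2 by rewrite divr_gt0.
have [z1 [h1 [Wz1 hh1 zz1]]] := cl _ _ (nbhs_interior Wz') e2.
have [n [n1 nW nh]] := zz1 _ _ Wz1 e2.
exists n; split => //; rewrite (splitr e); exact: cball_triangle hh1 nh.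
Qed.

Let frac_itv (x : R) : `[0, 1]%classic (x - (Num.floor x)%:~R).
Proof. by rewrite /= in_itv /=; have := floor_itv x; rewrite intrD; lra. Qed.

Let int_frac (x : R) : x - (x - (Num.floor x)%:~R) \is a Num.int.
Proof. by rewrite opprB addrC subrK intr_int. Qed.

(** Compactness of the fibre. *)
Lemma reach_exists z z' : universal S z -> exists h, reach z z' h.
Proof.
move=> Uz; apply: contrapT => /forallNP nreach.
pose P w (t : R) := forall n, (1 <= n)%N -> w = iter n S z ->
  ~ (t - birkhoff n z \is a Num.int).
have /compact_near_coveringP cov := @segment_compact R 0 1.
have [t _|n n1 /(_ _ (frac_itv _) n n1 erefl)] :=
  universal_hit Uz (cov _ (nbhs z') P _ _); last first.
  by apply; apply: int_subC; exact: int_frac.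
have /existsNP[W /existsNP[e /not_implyP[Wz' /not_implyP[e0 /forallNP nr]]]] := nreach t.
exists (ball t e, W); first by split => //=; exact: nbhsx_ballx.
move=> [t' w] /= [tt' Ww] n n1 wE t'n; apply: (nr n); split => //.
  by rewrite -wE.
by apply: cball_intr t'n _; exact: cball_norm.
Qed.

(** The set of [h] with [reach z0 z0 h] is a closed subsemigroup of the circle. If it is
not the whole circle, it consists of the [h] with [m h] integral, and the set of
[h] with [reach z0 z h] is one of its cosets for each [z] in [Y]; the graph of
[z |-> m h] is closed in a product with a compact factor, hence this function is
continuous. It is a transfer function: along [S] it grows by [m phi]. *)
Lemma extension_dichotomy (Y : set Z) z0 :
  Y `<=` universal S -> S @` Y `<=` Y -> Y z0 ->
  (forall z h, reach z0 z h) \/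
  exists m f, [/\ (0 < m)%N,
    forall h, m%:R * h \is a Num.int -> reach z0 z0 h,
    forall z, Y z -> {for z, continuous (f : Z -> circ R)} &
    forall z, Y z -> f (S z) - f z - m%:R * phi z \is a Num.int].
Proof.
move=> YU SY Yz0.
have /choice[h hP] z : exists h, reach z0 z h by exact/reach_exists/YU.
have [||||H1|[m m0 Hm]] := @closed_subsemigroup_circle R (reach z0 z0).
- by exists (h z0).
- by move=> a b; exact: reach_trans.
- move=> a k Ha kZ; apply: reach_int Ha.
  by rewrite opprD addrA subrr sub0r rpredN.
- move=> a cl; apply: reach_closed => W e Wz0 e0.
  have [k Hk ak] := cl e e0; exists z0, k; split => //.
    exact: nbhs_singleton.
  exact: cball_norm.
- left => z a; rewrite -(subrK (h z) a).
  by apply: reach_trans (hP z); rewrite H1.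
right; exists m, (fun z => m%:R * h z).
have mh z a b : Y z -> reach z0 z a -> reach z0 z b -> m%:R * a - m%:R * b \is a Num.int.
  move=> Yz za zb; have [k zk] := reach_exists z0 (YU _ Yz).
  have /Hm ak := reach_trans za zk; have /Hm bk := reach_trans zb zk.
  by apply: int_congr (rpredB ak bk) _; ring.
have mR : 0 < m%:R :> R by rewrite ltr0n.
split => // [a|z Yz|z Yz].
- by move/Hm.
- apply/circ_cvgP => e e0.
  pose P w (t : R) := reach z0 w t -> cball (m%:R * h z) e (m%:R * t).
  have /compact_near_coveringP cov := @segment_compact R 0 1.
  apply: (filterS _ (cov _ (nbhs z) P _ _)) => [w|t _].
    move=> /(_ _ (frac_itv (h w))) Pw.
    apply: cball_intr (Pw _); last by apply: reach_int (hP w); exact: int_frac.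
    rewrite -mulrBr rpredM ?rpred_nat//.
    by apply: int_subC; exact: int_frac.
  have [zt|nzt] := pselect (reach z0 z t).
    exists (ball t (e / m%:R), setT).
      by split; [apply: nbhsx_ballx; rewrite divr_gt0|exact: filterT].
    move=> [t' w] /= [tt' _] _; apply: cball_sym.
    apply: (cball_intr (mh _ _ _ Yz zt (hP z))).
    apply: cball_norm; rewrite -mulrBr normrM ger0_norm ?ltW// -ltr_pdivlMl//.
    by rewrite mulrC distrC.
  move/contra_not: (@reach_closed z0 z t) => /(_ nzt).
  move=> /existsNP[W /existsNP[d /not_implyP[Wz /not_implyP[d0 nr]]]].
  exists (ball t d, W); first by split => //=; exact: nbhsx_ballx.
  move=> [t' w] /= [tt' Ww] wt'; exfalso; apply: nr; exists w, t'; split => //.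
  exact: cball_norm.
- have YSz : Y (S z) by apply: SY; exists z.
  have := mh _ _ _ YSz (hP (S z)) (reach_trans (hP z) (@reach1 z)).
  by move/int_congr; apply; ring.
Qed.

End Extension.

Variable Y : set Z.
Hypotheses (YU : Y `<=` universal S) (SY : S @` Y `<=` Y).

Lemma sub_nbhs (z : Y) (U : set Y) : nbhs z U ->
  exists2 W : set Z, nbhs (set_val z) W & forall z' : Y, W (set_val z') -> U z'.
Proof.
move=> [_ [[W Wo <-] /= Wz WU]]; exists W; first exact: open_nbhs_nbhs.
by move=> z' ?; exact: WU.
Qed.

(** Universal points are recurrent, whereas [g] changes by [n c] after [n] steps. *)
Lemma no_drift (z0 : Y) (g : Y -> R) c : continuous g ->
  (forall z z' : Y, set_val z' = S (set_val z) -> g z' = g z + c) -> c = 0.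
Proof.
move=> gc gS.
have gn n : forall z' : Y, set_val z' = iter n S (set_val z0) -> g z' = g z0 + n%:R * c.
  elim: n => [|n IH] z' z'E.
    by rewrite mul0r addr0; congr g; exact: val_inj.
  have Yn := invariant_iter n SY (set_valP z0).
  rewrite (gS (to_sub Yn))//.
  by rewrite IH// -natr1 mulrDl mul1r addrA.
apply/eqP; apply/negPn/negP => c0.
have cp : 0 < `|c| by rewrite normr_gt0.
have /cvgrPdist_lt/(_ _ cp)/sub_nbhs[W Wz WU] := gc z0.
have [n n1 Wn] := universal_hit (YU (set_valP z0)) Wz.
have Yn := invariant_iter n SY (set_valP z0).
have := WU (to_sub Yn) Wn.
rewrite (gn n (to_sub Yn))// opprD addrA subrr sub0r normrN normrM normr_nat.
by rewrite gtr_pMl// ltrn1 ltnNge n1.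
Qed.

(** The orbit of [z] stays in [Y] and accumulates at [z']. *)
Lemma invariant_cst (f : Y -> R) : continuous (f : Y -> circ R) ->
  (forall z z' : Y, set_val z' = S (set_val z) -> f z' - f z \is a Num.int) ->
  forall z z' : Y, f z - f z' \is a Num.int.
Proof.
move=> fc fS z z'.
have fn n : forall z' : Y, set_val z' = iter n S (set_val z) -> f z' - f z \is a Num.int.
  elim: n => [|n IH] w wE.
    by rewrite (val_inj wE) subrr rpred0.
  have Yn := invariant_iter n SY (set_valP z).
  pose v : Y := to_sub Yn.
  by apply: int_congr (rpredD (fS v w wE) (IH v erefl)) _; rewrite addrA subrK.
apply: cball_eq_int => e e0.
have Uz : nbhs z' [set v | cball (f z') e (f v)].
  exact: (proj1 (circ_cvgP _ _ _) (fc z') e e0).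
have [W Wz WU] := sub_nbhs Uz.
have [n n1 Wn] := universal_hit (YU (set_valP z)) Wz.
have Yn := invariant_iter n SY (set_valP z).
pose v : Y := to_sub Yn.
apply: cball_sym; apply: cball_intr (WU v Wn); exact: (fn n).
Qed.

Definition sub_map (z : Y) : Y :=
  to_sub (SY (ex_intro2 _ _ _ (set_valP z) erefl)).

Lemma sub_map_continuous : continuous sub_map.
Proof.
apply: continuous_comp_initial => z.
by apply: (@continuous_comp _ _ _ set_val S); [exact: initial_continuous|exact: Sc].
Qed.

(** This is where the topology of [Y] enters: [f] lifts to a real function [h], which
grows by a constant congruent to [c] along [S], since [Y] is connected; by
[no_drift] this constant is 0. *)
Lemma rotation_number (f : Y -> R) (c : R) : Y !=set0 ->
  locally_path_connected R Y -> simply_connected R Y ->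
  continuous (f : Y -> circ R) ->
  (forall z z' : Y, set_val z' = S (set_val z) -> f z' - f z - c \is a Num.int) ->
  c \is a Num.int.
Proof.
move=> [z0 Yz0] lpc sc fc fS.
have [h hc hf] := simply_connected_lift lpc sc fc.
pose k (z : Y) := h (sub_map z) - h z - c.
have kZ (z : Y) : k z \is a Num.int.
  apply: int_congr (rpredD (fS z (sub_map z) erefl)
    (rpredB (hf (sub_map z)) (hf z))) _; rewrite /k; ring.
have kc : continuous k := displacement_continuous (c:=c) hc sub_map_continuous.
have kcst (z z' : Y) : k z = k z'.
  have [[_ pc] _] := sc; have [g [gc <- <-]] := path_fun (pc z z').
  apply: (@continuous_int_cst R (k \o g)) => [t|t]; last exact: kZ.
  by apply: continuous_comp; [exact: gc|exact: kc].
pose y0 : Y := to_sub Yz0.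
have : k y0 + c = 0.
  apply: (no_drift y0 hc) => z z' z'E.
  have -> : z' = sub_map z by exact: val_inj.
  by rewrite (kcst y0 z) /k; ring.
by move=> /eqP; rewrite addrC addr_eq0 => /eqP ->; rewrite rpredN.
Qed.

End Dynamics.

(** * The tower of circle extensions *)

(** A continuous additive map of the circle lifts on [0, 1] to an additive [d]. The
function [|d t - t d 1|] attains its maximum; additivity doubles it at [2 t] for
[t <= 1/2] and leaves it unchanged under [t |-> 1 - t], so that the maximum is 0. *)
Lemma circle_character (R : realType) (chi : R -> R) :
  continuous (chi : R -> circ R) ->
  (forall t t', chi (t + t') - (chi t + chi t') \is a Num.int) ->
  chi 1 \is a Num.int ->
  exists j : int, forall t, chi t - j%:~R * t \is a Num.int.
Proof.
move=> chic chiD chi1.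
have chi0 : chi 0 \is a Num.int.
  by rewrite -rpredN; apply: int_congr (chiD 0 0) _; rewrite addr0; ring.
have [d dl] := path_lift chic; have [d0 dc dZ'] := dl.
have dZ t : 0 <= t <= 1 -> d t - chi t \is a Num.int.
  by move=> t01; apply: int_congr (rpredB (dZ' t t01) chi0) _; ring.
have i01 : 0 <= (1 : R) <= 1 by rewrite ler01 lexx.
have /intrP[j jE] : d 1 \is a Num.int.
  by rewrite -(subrK (chi 1) (d 1)) rpredD// dZ.
have dbl t : 0 <= t <= 1 -> d t = 2 * d (t / 2).
  apply: (@lift_unique R d (fun t => 2 * d (t / 2))) => [||| s s01].
  - exact: dc.
  - move=> s; apply: cvgM; first exact: cvg_cst.
    apply: (@continuous_comp R R R (fun s : R => s / 2) d); last exact: dc.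
    by apply: cvgM; [exact: cvg_id|exact: cvg_cst].
  - by rewrite mul0r d0 mulr0.
  have s2 : 0 <= s / 2 <= 1 by lra.
  apply: int_congr (rpredD (rpredB (dZ s s01)
    (rpredM (rpred_nat _ 2) (dZ _ s2))) (chiD (s / 2) (s / 2))) _.
  by rewrite -splitr; ring.
have refl t : 0 <= t <= 1 -> d t = d 1 - d (1 - t).
  apply: (@lift_unique R d (fun t => d 1 - d (1 - t))) => [||| s s01].
  - exact: dc.
  - move=> s; apply: cvgB; first exact: cvg_cst.
    apply: (@continuous_comp R R R (fun s : R => 1 - s) d); last exact: dc.
    by apply: cvgB; [exact: cvg_cst|exact: cvg_id].
  - by rewrite subr0 subrr d0.
  have s1 : 0 <= 1 - s <= 1 by lra.
  apply: int_congr (rpredB (rpredD (dZ _ s01) (dZ _ s1))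
    (rpredD (chiD s (1 - s)) (dZ _ i01))) _.
  by rewrite (_ : s + (1 - s) = 1); ring.
pose g t := `|d t - t * d 1|.
have gc : continuous g.
  move=> t; apply: cvg_norm; apply: cvgB; first exact: dc.
  by apply: cvgM; [exact: cvg_id|exact: cvg_cst].
have [c] := EVT_max (@ler01 R) (continuous_subspaceT gc).
rewrite in_itv /= => c01 gmax.
have gdbl t : 0 <= t <= 1/2 -> g (2 * t) = 2 * g t.
  move=> t12; rewrite /g dbl; last by lra.
  rewrite (_ : 2 * t / 2 = t); last by field.
  by rewrite (_ : _ - _ = 2 * (d t - t * d 1)); [rewrite normrM normr_nat|ring].
have grefl t : 0 <= t <= 1 -> g t = g (1 - t).
  move=> t01; rewrite /g refl// -normrN; congr `|_|; ring.
have gc0 : g c = 0.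
  apply/eqP; rewrite eq_le normr_ge0 andbT.
  have [c2|c2] := leP c (1/2).
    have := gmax (2 * c); rewrite in_itv /= gdbl; last by lra.
    by move=> /(_ ltac:(lra)); lra.
  have := gmax (2 * (1 - c)); rewrite in_itv /= gdbl; last by lra.
  by rewrite -grefl// => /(_ ltac:(lra)); lra.
have dj t : 0 <= t <= 1 -> d t = j%:~R * t.
  move=> t01; apply/eqP; rewrite -jE mulrC -subr_eq0 -normr_eq0 -/(g t).
  by rewrite eq_le normr_ge0 andbT -gc0 gmax// in_itv.
have base t : 0 <= t <= 1 -> chi t - j%:~R * t \is a Num.int.
  by move=> t01; rewrite -dj//; apply: int_subC; exact: dZ.
exists j.
have mult n t : 0 <= t <= 1 -> chi (n%:R * t) - j%:~R * (n%:R * t) \is a Num.int.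
  move=> t01; elim: n => [|n IH]; first by rewrite mul0r mulr0 subr0.
  apply: int_congr (rpredD (rpredD IH (base t t01)) (chiD (n%:R * t) t)) _.
  by rewrite -natr1 mulrDl mul1r; ring.
have pos t : 0 <= t -> chi t - j%:~R * t \is a Num.int.
  move=> t0; have /andP[_ tn] := truncn_itv t0.
  have n0 : 0 < (Num.truncn t).+1%:R :> R by rewrite ltr0n.
  have -> : t = (Num.truncn t).+1%:R * (t / (Num.truncn t).+1%:R).
    by rewrite mulrC divfK// gt_eqF.
  by apply: mult; rewrite divr_ge0 ?ler0n//= ler_pdivrMr// mul1r ltW.
move=> t; have [/pos//|t0] := leP 0 t.
have nt : 0 <= - t by lra.
apply: int_congr (rpredB (rpredB chi0 (chiD t (- t))) (pos _ nt)) _.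
by rewrite subrr; ring.
Qed.

Section Tower.
Variables (R : realType) (X : topologicalType) (T : X -> X).
Variables (Y : set X) (s : nat) (beta : nat -> R).

(** The product of [X] with [D] circles, built one factor at a time. Under [tower_map],
coordinate [i < s] is rotated by [beta i], and coordinate [i >= s] receives the
value of coordinate [i - s]. With [D = K s] coordinates, coordinate [k s + i]
of the [n]-th iterate of the point above [x] with zero phases is the binomial
coefficient of [n] and [k + 1], times [beta i]. *)
Fixpoint tower (D : nat) : topologicalType :=
  if D is D'.+1 then (tower D' * circ R)%type else X.

Fixpoint phase_coord (D i : nat) : tower D -> R :=
  match D with
  | 0 => fun=> 0
  | D'.+1 => fun z => if i == D' then z.2 else phase_coord i z.1
  end.

(** The increment of coordinate [D] above a point of the tower of height [D]. *)
Definition cocycle (D : nat) (z : tower D) : R :=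
  if (D < s)%N then beta D else phase_coord (D - s) z.

Fixpoint tower_map (D : nat) : tower D -> tower D :=
  match D with
  | 0 => T
  | D'.+1 => fun z => (@tower_map D' z.1, (z.2 : R) + cocycle z.1)
  end.

Fixpoint tower_set (D : nat) : set (tower D) :=
  match D with 0 => Y | D'.+1 => [set z | @tower_set D' z.1] end.

Fixpoint phase_shift (D i : nat) (t : R) : tower D -> tower D :=
  match D with
  | 0 => id
  | D'.+1 => fun z => (@phase_shift D' i t z.1, if i == D' then (z.2 : R) + t else z.2)
  end.

Fixpoint tower_pt (D : nat) (x : X) : tower D :=
  match D with 0 => x | D'.+1 => (tower_pt D' x, 0 : R) end.

Hypothesis Tc : continuous T.
Hypothesis TY : T @` Y `<=` Y.

Lemma phase_coord_continuous D i : continuous (@phase_coord D i : tower D -> circ R).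
Proof.
elim: D => [|D IH] /= z; first exact: cvg_cst.
case: eqP => _; first exact: cvg_snd.
by apply: (@continuous_comp _ _ (circ R) fst (@phase_coord D i));
  [exact: cvg_fst|exact: IH].
Qed.

Lemma cocycle_continuous D : continuous (@cocycle D : tower D -> circ R).
Proof.
rewrite /cocycle => z; case: (D < s)%N; first exact: cvg_cst.
exact: phase_coord_continuous.
Qed.

Lemma tower_map_continuous D : continuous (@tower_map D).
Proof.
elim: D => [|D IH] /=; first exact: Tc.
move=> z; apply: cvg_pairt.
  by apply: (@continuous_comp _ _ _ fst (@tower_map D)); [exact: cvg_fst|exact: IH].
apply: circ_cvgD; first exact: cvg_snd.
by apply: (@continuous_comp _ _ (circ R) fst (@cocycle D));
  [exact: cvg_fst|exact: cocycle_continuous].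
Qed.

Lemma phase_shift_continuous D i :
  continuous (fun p : tower D * R => phase_shift i p.2 p.1).
Proof.
elim: D => [|D IH] /= p; first exact: cvg_fst.
have c1 : (fun q : tower D * circ R * R => q.1.1) @ p --> p.1.1.
  by apply: (@continuous_comp _ _ _ fst fst); exact: cvg_fst.
have c2 : (fun q : tower D * circ R * R => q.1.2) @ p --> p.1.2.
  by apply: (@continuous_comp _ _ _ fst snd); [exact: cvg_fst|exact: cvg_snd].
apply: cvg_pairt.
  apply: (@continuous_comp _ _ _ (fun q : tower D * circ R * R => (q.1.1, q.2))
    (fun p : tower D * R => phase_shift i p.2 p.1)); last exact: IH.
  by apply: cvg_pairt => //; exact: cvg_snd.
case: eqP => _ //; apply: circ_cvgD => //.
by apply: circ_cvg; exact: cvg_snd.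
Qed.

Lemma tower_set_invariant D : @tower_map D @` @tower_set D `<=` @tower_set D.
Proof.
elim: D => [|D IH] //= _ [z Yz <-] /=.
by apply: IH; exists z.1.
Qed.

Lemma tower_set_shift D i t z : @tower_set D z -> tower_set (phase_shift i t z).
Proof. by elim: D z => //= D IH z; exact: IH. Qed.

Lemma tower_set_pt D x : Y x -> tower_set (tower_pt D x).
Proof. by elim: D => /=. Qed.

Lemma phase_shift_out D i t (z : tower D) : (D <= i)%N -> phase_shift i t z = z.
Proof.
elim: D z => //= D IH [z h] Di /=.
by rewrite IH 1?ltnW// gtn_eqF.
Qed.

Lemma phase_shiftD D i t t' (z : tower D) :
  phase_shift i (t + t') z = phase_shift i t' (phase_shift i t z).
Proof.
elim: D z => //= D IH z; rewrite IH; congr pair.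
by case: eqP => //= _; rewrite addrA.
Qed.

Lemma phase_coord_shift D i j t (z : tower D) : (i < D)%N ->
  phase_coord j (phase_shift i t z) = phase_coord j z + (if j == i then t else 0).
Proof.
elim: D z => //= D IH z; rewrite ltnS leq_eqVlt => /orP[/eqP->|iD].
  by rewrite eqxx phase_shift_out//; case: eqP => // _; rewrite addr0.
rewrite (ltn_eqF iD); case: eqP => [->|_]; last exact: IH.
by rewrite (gtn_eqF iD) addr0.
Qed.

(** The hypothesis says that coordinate [i] has not yet been used as an
increment: coordinate [i + s] does not exist. *)
Lemma tower_map_phase_shift D i t (z : tower D) : (i < D)%N -> (D <= i + s)%N ->
  tower_map (phase_shift i t z) = phase_shift i t (tower_map z).
Proof.
elim: D z => //= D IH z; rewrite ltnS leq_eqVlt => /orP[/eqP->|iD] Dis.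
  by rewrite !phase_shift_out// eqxx addrAC.
rewrite (IH _ iD (ltnW Dis)) (ltn_eqF iD); congr (_, _ + _).
rewrite /cocycle; case: ltnP => // sD.
rewrite phase_coord_shift// ifF ?addr0//; apply/negbTE.
by rewrite neq_ltn ltn_subLR// addnC Dis.
Qed.

Lemma phase_coord_tower_map D i (z : tower D) : (0 < s)%N -> (i < D)%N ->
  phase_coord i (tower_map z) = phase_coord i z +
    (if (i < s)%N then beta i else phase_coord (i - s) z).
Proof.
move=> s0; elim: D z => //= D IH z; rewrite ltnS leq_eqVlt => /orP[/eqP->|iD].
  rewrite eqxx /cocycle; case: ltnP => // sD; rewrite ltn_eqF//.
  by rewrite ltn_subrL s0 (leq_trans s0 sD).
rewrite (ltn_eqF iD) IH//; case: ltnP => // si; rewrite ltn_eqF//.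
exact: leq_ltn_trans (leq_subr _ _) iD.
Qed.

Lemma iter_tower_map D n (z : tower D) (a : R) :
  iter n (@tower_map D.+1) (z, a) =
  (iter n (@tower_map D) z, a + birkhoff (@tower_map D) (@cocycle D) n z).
Proof.
rewrite /birkhoff; elim: n => [|n IH]; first by rewrite big_ord0 addr0.
by rewrite iterS IH /= big_ord_recr /= addrA.
Qed.

(** Shifting a coordinate by an integer gives a point that no open set separates
from the original one. *)
Lemma phase_shift_int D i (k : R) (z : tower D) (W : set (tower D)) :
  k \is a Num.int -> nbhs z W -> W (phase_shift i k z).
Proof.
move=> kZ; elim: D z W => [|D IH] /=; first by move=> z W /nbhs_singleton.
move=> [z h] W [[A B] /= [zA hB] ABW]; apply: ABW; split => /=; first exact: IH.
case: eqP => _; last exact: nbhs_singleton.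
have /nbhs_ballP[e /= e0 eB] := hB; apply: eB.
apply: cball_int => //; by rewrite opprD addrA subrr sub0r rpredN.
Qed.

End Tower.

Lemma continuous_pair_cst (A B C : topologicalType) (u : A -> B) (c : C) :
  continuous u -> continuous (fun a => (u a, c)).
Proof. by move=> uc a; apply: cvg_pairt; [exact: uc|exact: cvg_cst]. Qed.

Lemma circ_continuousB (R : realType) (A : topologicalType) (u v : A -> R) :
  continuous (u : A -> circ R) -> continuous (v : A -> circ R) ->
  continuous ((fun a => u a - v a) : A -> circ R).
Proof. by move=> uc vc a; apply: circ_cvgB; [exact: uc|exact: vc]. Qed.

(** Linear independence over the rationals of 1 and the [b i], [i < s]. *)
Definition free_mod1 (R : realType) (s : nat) (b : nat -> R) : Prop :=
  forall c : nat -> int, \sum_(i < s) (c i)%:~R * b i \is a Num.int ->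
  forall i, (i < s)%N -> c i = 0.

Section TowerUniversal.
Variables (R : realType) (X : topologicalType) (T : X -> X).
Variables (Y : set X) (s : nat) (beta : nat -> R).
Hypotheses (Tc : continuous T) (TY : T @` Y `<=` Y) (YU : Y `<=` universal T).
Hypotheses (Y0 : Y !=set0) (lpc : locally_path_connected R Y)
  (sc : simply_connected R Y).
Hypothesis beta_free : free_mod1 s beta.

Local Notation tw := (tower R X).
Local Notation S D := (@tower_map R X T s beta D).
Local Notation YY D := (@tower_set R X Y D).
Local Notation phi D := (@cocycle R X s beta D).

Lemma tower_universalS D :
  (forall z0 z h, YY D z0 -> reach (S D) (phi D) z0 z h) ->
  YY D.+1 `<=` universal (S D.+1).
Proof.
move=> H [z a] /= Yz U [[z' b] Uz] Uo.
have [[A B] /= [Az Bb] AB] := open_nbhs_nbhs (conj Uo Uz).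
have /nbhs_ballP[e /= e0 eB] := Bb.
have [n [n1 An bn]] := H z z' (b - a) Yz A e Az e0.
exists (iter n (S D.+1) (z, a)); split; last by exists n.
rewrite iter_tower_map; apply: AB; split => //=; apply: eB.
apply: cball_sym; apply/cball0B; move/cball_sym/cball0B: bn.
by rewrite (_ : b - a - _ = b - (a + birkhoff (S D) (phi D) n z)); last by ring.
Qed.

(** The new coordinate is driven by coordinate [i = D - s]. For a transfer function
[f] with [f (S z) = f z + m z_i], let [g] be the variation of [f] when [z_i] makes a
full turn. Turning coordinate [i] commutes with [S], hence [g (S z) = g z + m],
which [no_drift] forbids. *)
Lemma tower_step_high D z0 : (0 < s)%N -> (s <= D)%N -> YY D `<=` universal (S D) ->
  YY D z0 -> forall z h, reach (S D) (phi D) z0 z h.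
Proof.
move=> s0 sD YYU Yz0.
have SY := @tower_set_invariant R X T Y s beta TY D.
have [//|[m [f [m0 _ fc fS]]]] := extension_dichotomy
  (@tower_map_continuous R X T s beta Tc D) (@cocycle_continuous R X s beta D)
  YYU SY Yz0.
exfalso; pose i := (D - s)%N.
have iD : (i < D)%N by rewrite ltn_subrL s0 (leq_trans s0 sD).
have Dis : (D <= i + s)%N by rewrite subnK.
pose F (z : YY D) (t : R) := f (phase_shift i t (set_val z)).
have Yz (z : YY D) t : YY D (phase_shift i t (set_val z)).
  by apply: tower_set_shift; exact: set_valP.
have Fc : continuous ((fun p => F p.1 p.2) : YY D * R -> circ R).
  move=> p; apply: (@continuous_comp _ _ (circ R)
    (fun p : YY D * R => phase_shift i p.2 (set_val p.1)) f); last exact/fc/Yz.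
  apply: (@continuous_comp _ _ _ (fun p : YY D * R => (set_val p.1, p.2))
    (fun p : tw D * R => phase_shift i p.2 p.1)); last exact: phase_shift_continuous.
  apply: cvg_pairt; last exact: cvg_snd.
  apply: (@continuous_comp _ _ _ fst set_val); first exact: cvg_fst.
  exact: initial_continuous.
have [d [d0 dZ dc dc']] := fibre_lift Fc.
have i01 : 0 <= (1 : R) <= 1 by rewrite ler01 lexx.
have FS (z z' : YY D) t : set_val z' = S D (set_val z) ->
    F z' t - F z t - m%:R * (cocycle s beta (set_val z) + t) \is a Num.int.
  move=> z'E; rewrite /F z'E -(@tower_map_phase_shift R X T s beta D i t _ iD Dis).
  apply: int_congr (fS _ (Yz z t)) _.
  rewrite /cocycle ltnNge sD /= phase_coord_shift// eqxx; ring.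
have : m%:R = 0 :> R.
  apply: (no_drift YYU SY (to_sub Yz0) (dc' 1 i01)) => z z' z'E.
  rewrite -[m%:R]mulr1.
  apply: (@lift_unique R (d z') (fun t => d z t + m%:R * t)) i01.
  - exact: dc.
  - move=> t; apply: cvgD; first exact: dc.
    by apply: cvgM; [exact: cvg_cst|exact: cvg_id].
  - by rewrite !d0 mulr0 addr0.
  move=> t t01; apply: int_congr (rpredD (rpredB (dZ z' t t01) (dZ z t t01))
    (rpredB (FS z z' t z'E) (FS z z' 0 z'E))) _.
  by ring.
by move=> /eqP; rewrite pnatr_eq0 => /eqP m00; rewrite m00 in m0.
Qed.

(** Rotation of the coordinates [i < k] by [beta i]. *)
Fixpoint fibre_rotate (D k : nat) (z : tw D) : tw D :=
  if k is k'.+1 then phase_shift k' (beta k') (fibre_rotate k' z) else z.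

Lemma fibre_rotateS D k (z : tw D) (a : R) : (k <= D)%N ->
  fibre_rotate k ((z, a) : tw D.+1) = (fibre_rotate k z, a).
Proof.
elim: k => //= k IH kD.
by rewrite IH 1?ltnW//= ltn_eqF.
Qed.

Lemma tower_map_pt D x : (D <= s)%N ->
  S D (tower_pt R D x) = fibre_rotate D (tower_pt R D (T x)).
Proof.
elim: D => //= D IH Ds; rewrite IH 1?ltnW// fibre_rotateS//=.
by rewrite phase_shift_out// eqxx /cocycle Ds.
Qed.

Lemma tower_pt_continuous D : continuous (@tower_pt R X D).
Proof.
elim: D => [|D IH] x /=; first exact: cvg_id.
by apply: cvg_pairt; [exact: IH|exact: cvg_cst].
Qed.

(** All coordinates are rotations, and each of them may be turned by any angle [t]
in a way commuting with [S]. The resulting increment of a transfer function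
[f] is [S]-invariant, hence depends on [t] only, as a character [t |-> j i t] of
the circle. Turning all coordinates back therefore shows that
[m beta D - sum j i beta i] is the constant by which the restriction of [f] to the
zero section [Y] grows along [T]. It is an integer by [rotation_number], which
contradicts the independence of the [beta i]. *)
Lemma tower_step_low D z0 : (D < s)%N -> YY D `<=` universal (S D) ->
  YY D z0 -> forall z h, reach (S D) (phi D) z0 z h.
Proof.
move=> Ds YYU Yz0.
have SY := @tower_set_invariant R X T Y s beta TY D.
have [//|[m [f [m0 _ fc fS]]]] := extension_dichotomy
  (@tower_map_continuous R X T s beta Tc D) (@cocycle_continuous R X s beta D)
  YYU SY Yz0.
exfalso.
have phiE z : phi D z = beta D by rewrite /cocycle Ds.
have Yst i t z : YY D z -> YY D (phase_shift i t z) by exact: tower_set_shift.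
have fshift i t : continuous
    ((fun z : YY D => f (phase_shift i t (set_val z))) : YY D -> circ R).
  move=> z; apply: (@continuous_comp _ _ (circ R)
    (fun z : YY D => phase_shift i t (set_val z)) f).
    apply: (@continuous_comp _ _ _ (fun z : YY D => (set_val z, t))
      (fun p : tw D * R => phase_shift i p.2 p.1)); last exact: phase_shift_continuous.
    exact: (continuous_pair_cst (@initial_continuous _ _ set_val)).
  by apply: fc; apply: Yst; exact: set_valP.
have fval : continuous ((fun z : YY D => f (set_val z)) : YY D -> circ R).
  move=> z; apply: (@continuous_comp _ _ (circ R) set_val f).
    exact: initial_continuous.
  by apply: fc; exact: set_valP.
have /choice[j jP] (i : 'I_D) : exists j : int, forall t z, YY D z ->
    f (phase_shift i t z) - f z - j%:~R * t \is a Num.int.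
  pose chi t := f (phase_shift i t z0) - f z0.
  have chiP t z : YY D z -> f (phase_shift i t z) - f z - chi t \is a Num.int.
    move=> Yz; have := @invariant_cst R (tw D) (S D) (YY D) YYU SY
      (fun z : YY D => f (phase_shift i t (set_val z)) - f (set_val z)) _ _
      (to_sub Yz) (to_sub Yz0); apply.
      exact: (circ_continuousB (fshift i t) fval).
    move=> w w' /= ->.
    rewrite -(@tower_map_phase_shift R X T s beta D i t _ (ltn_ord i)); last first.
      by rewrite (leq_trans (ltnW Ds))// leq_addl.
    apply: int_congr (rpredB (fS _ (Yst i t _ (set_valP w))) (fS _ (set_valP w))) _.
    by rewrite !phiE; ring.
  have [|||j jP] := @circle_character R chi.
  - move=> t; apply: circ_cvgB; last exact: cvg_cst.
    apply: (@continuous_comp _ _ (circ R) (fun t : R => phase_shift i t z0) f).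
      apply: (@continuous_comp _ _ _ (fun t : R => (z0, t))
        (fun p : tw D * R => phase_shift i p.2 p.1)); last exact: phase_shift_continuous.
      by apply: cvg_pairt; [exact: cvg_cst|exact: cvg_id].
    by apply: fc; exact: Yst.
  - move=> t t'; apply: int_congr (chiP t' _ (Yst i t _ Yz0)) _.
    by rewrite /chi phase_shiftD; ring.
  - apply: int_subC; apply: cball_eq_int => e e0.
    have := @phase_shift_int R X D i 1 z0 _ (rpred1 _)
      (proj1 (circ_cvgP _ _ _) (fc z0 Yz0) e e0).
    by apply; exact: nbhs_filter.
  - exists j => t z Yz.
    by apply: int_congr (rpredD (chiP t z Yz) (jP t)) _; ring.
(* The integer relation between 1 and the [beta i]; its coefficient at [D] is [m]. *)
pose c (i : nat) : int :=
  if i == D then m%:Z else if insub i is Some i' then - j i' else 0.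
pose kappa := \sum_(i < s) (c i)%:~R * beta i.
have kappaE : kappa = m%:R * beta D - \sum_(i < D) (j i)%:~R * beta i.
  rewrite /kappa -(big_mkord predT (fun i => (c i)%:~R * beta i)).
  rewrite (big_cat_nat (leq0n D.+1) Ds) /= big_nat_recr//= {2}/c eqxx.
  rewrite [X in _ + X]big1_seq => [|i]; last first.
    rewrite /= mem_index_iota => /andP[Di _].
    by rewrite /c gtn_eqF// insubF ?mul0r//; apply/negbTE; rewrite -leqNgt ltnW.
  rewrite addr0 addrC -pmulrn big_mkord; congr (_ + _); rewrite -sumrN.
  apply: eq_bigr => i _; rewrite /c ltn_eqF// insubT//= => iD.
  by rewrite rmorphN mulNr (_ : Sub _ _ = i)//; exact: val_inj.
have rot k z : (k <= D)%N -> YY D z -> YY D (fibre_rotate k z) /\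
    f (fibre_rotate k z) - f z - \sum_(i < D | (i < k)%N) (j i)%:~R * beta i
      \is a Num.int.
  move=> + Yz; elim: k => [|k IH] kD.
    by split=> //; rewrite big_pred0// subr0 subrr rpred0.
  have [Yw wP] := IH (ltnW kD); split; first exact: Yst.
  rewrite (bigD1 (Ordinal kD)) ?ltnSn//=.
  rewrite (eq_bigl (fun i : 'I_D => (i < k)%N)) => [|i]; last first.
    by rewrite ltnS -val_eqE /= ltn_neqAle andbC.
  by apply: int_congr (rpredD wP (jP (Ordinal kD) (beta k) _ Yw)) _; rewrite /=; ring.
have kZ : kappa \is a Num.int.
  apply: (rotation_number Tc YU TY
    (f := fun y : Y => f (tower_pt R D (set_val y))) Y0 lpc sc).
    move=> y; apply: (@continuous_comp _ _ (circ R)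
      (fun y : Y => tower_pt R D (set_val y)) f).
      apply: (@continuous_comp _ _ _ set_val (@tower_pt R X D)).
        exact: initial_continuous.
      exact: tower_pt_continuous.
    by apply: fc; apply: tower_set_pt; exact: set_valP.
  move=> y y' y'E.
  have Yy : YY D (tower_pt R D (set_val y)) by apply: tower_set_pt; exact: set_valP.
  have Yy' : YY D (tower_pt R D (set_val y')) by apply: tower_set_pt; exact: set_valP.
  have [_ r] := rot D _ (leqnn D) Yy'.
  have sumD : \sum_(i < D | (i < D)%N) (j i)%:~R * beta i =
      \sum_(i < D) (j i)%:~R * beta i.
    by apply: eq_bigl => i; rewrite ltn_ord.
  have := fS _ Yy; rewrite tower_map_pt 1?ltnW// -y'E phiE => h.
  apply: int_congr (rpredB h r) _.
  by rewrite kappaE sumD; ring.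
have := beta_free kZ Ds; rewrite /c eqxx => -[m00].
by rewrite m00 in m0.
Qed.

(** When [s = 0] there is no coordinate to add. *)
Lemma tower_universal D : (0 < s)%N \/ D = 0 -> YY D `<=` universal (S D).
Proof.
elim: D => [|D IH] // [s0|//].
have {}IH := IH (or_introl s0).
apply: tower_universalS => z0 z h Yz0.
by case: (ltnP D s) => Ds; [exact: tower_step_low|exact: tower_step_high].
Qed.

End TowerUniversal.

(** * Bohr neighbourhoods in compact groups *)

Section FiniteFourier.
Variable R : realType.

(** The angle, in radians, of [x] turns. *)
Definition turn (x : R) : R := pi *+ 2 * x.

Lemma cos_turn_int (x k : R) : k \is a Num.int -> cos (turn (x + k)) = cos (turn x).
Proof.
move=> /intrP[z ->]; case: z => n.
  by rewrite /turn mulrDr -pmulrn mulr_natr (periodicn (@cosD2pi R)).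
rewrite NegzE mulrNz -pmulrn.
rewrite -[LHS](periodicn (@cosD2pi R) n.+1) /turn; congr cos.
by rewrite -[_ *+ n.+1]mulr_natr; ring.
Qed.

Lemma cos_turn_ge0 (x : R) : cball 0 (1/4) x -> 0 <= cos (turn x).
Proof.
move=> [k kZ]; rewrite sub0r -opprD normrN => xk.
rewrite -(@cos_turn_int _ k)//; apply: cos_ge0_pihalf.
have p0 := pi_gt0 R; move: xk; rewrite ltr_norml => /andP[x1 x2].
by rewrite /turn; apply/andP; split; nra.
Qed.

(** Multiplied by the sine of half the common difference, the sum telescopes. *)
Lemma sum_cos_turn (M k : nat) : (0 < k < M)%N ->
  \sum_(i < M) cos (turn (k%:R * (i%:R / M%:R))) = 0.
Proof.
move=> /andP[k0 kM].
have M0 : M%:R != 0 :> R by rewrite pnatr_eq0 -lt0n (leq_ltn_trans _ kM).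
have Mp : 0 < M%:R :> R by rewrite lt0r M0 ler0n.
pose h : R := pi * (k%:R / M%:R).
have p0 := pi_gt0 R.
have h0 : sin h != 0.
  rewrite gt_eqF// sin_gt0_pi//; apply/andP; split.
    by rewrite mulr_gt0// divr_gt0// ltr0n.
  by rewrite gtr_pMr// ltr_pdivrMr// mul1r ltr_nat.
apply: (mulfI h0); rewrite mulr0 mulr_sumr.
pose u (i : nat) : R := sin (i%:R * (h *+ 2) - h) / 2.
rewrite (eq_bigr (fun i : 'I_M => u i.+1 - u i)) => [|i _]; last first.
  have -> : turn (k%:R * (i%:R / M%:R)) = i%:R * (h *+ 2).
    by rewrite /turn /h; ring.
  rewrite /u -natr1 mulrDl mul1r [h *+ 2]mulr2n.
  set b := i%:R * _; rewrite (_ : b + (h + h) - h = b + h); last by ring.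
  by rewrite sinD sinB; field.
rewrite -(big_mkord predT (fun i => u i.+1 - u i)) telescope_sumr//.
rewrite /u mul0r.
have -> : M%:R * (h *+ 2) - h = 0 - h + (pi *+ 2) *+ k.
  by rewrite /h -[_ *+ k]mulr_natr; field.
by rewrite (periodicn (@sinD2pi R)) subrr.
Qed.

Variables (N M : nat) (A : {set 'I_N}).

Let C (x : R) := \sum_(a in A) cos (turn (a%:R * x)).
Let D (x : R) := \sum_(a in A) sin (turn (a%:R * x)).
(** The squared modulus of the Fourier transform of [A] at [x]. *)
Definition energy (x : R) : R := C x ^+ 2 + D x ^+ 2.

Lemma energy_ge0 x : 0 <= energy x.
Proof. by rewrite addr_ge0 ?sqr_ge0. Qed.

Lemma energy0 : energy 0 = #|A|%:R ^+ 2.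
Proof.
rewrite /energy /C /D.
under eq_bigr do rewrite /turn !mulr0 cos0.
under [X in _ + X ^+ 2]eq_bigr do rewrite /turn !mulr0 sin0.
by rewrite sumr_const [X in _ + X ^+ 2]big1// expr0n addr0.
Qed.

(** The case of a pair of points of [A] in the expansion of powers of [energy];
the sine terms cancel by symmetry. *)
Lemma energy_cos x y : energy x * cos y =
  \sum_(a in A) \sum_(b in A) cos (turn ((a%:R - b%:R) * x) + y).
Proof.
have E a b : cos (turn ((a%:R - b%:R) * x) + y) =
    (cos (turn (a%:R * x)) * cos y - sin (turn (a%:R * x)) * sin y) * cos (turn (b%:R * x))
  + (sin (turn (a%:R * x)) * cos y + cos (turn (a%:R * x)) * sin y) * sin (turn (b%:R * x)).
  have -> : turn ((a%:R - b%:R) * x) + y = (turn (a%:R * x) + y) - turn (b%:R * x).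
    by rewrite /turn; ring.
  by rewrite cosB cosD sinD.
under eq_bigr => a _ do under eq_bigr => b _ do rewrite E.
under eq_bigr => a _ do rewrite big_split/= -!mulr_sumr -/(C x) -/(D x).
rewrite big_split/= -!mulr_suml sumrB big_split/= -!mulr_suml -/(C x) -/(D x).
by rewrite /energy; ring.
Qed.

Lemma energyE x :
  energy x = \sum_(a in A) \sum_(b in A) cos (turn ((a%:R - b%:R) * x) + 0).
Proof. by rewrite -energy_cos cos0 mulr1. Qed.

Hypothesis ME : M = (4 * N)%N.
Hypothesis N0 : (0 < N)%N.

Let M0 : (0 < M)%N. Proof. by lia. Qed.

Let sum_cos_int (k : int) : k != 0 -> `|k| < M%:Z ->
  \sum_(i < M) cos (turn (k%:~R * (i%:R / M%:R))) = 0 :> R.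
Proof.
move=> k0 kM; have kn : (0 < `|k| < M)%N by lia.
transitivity (\sum_(i < M) cos (turn (`|k|%N%:R * (i%:R / M%:R)))); last first.
  exact: sum_cos_turn.
apply: eq_bigr => i _.
have [kE|kE] : k = `|k|%N%:Z \/ k = - `|k|%N%:Z by lia.
  by rewrite {1}kE -pmulrn.
by rewrite {1}kE mulrNz -pmulrn -cosN /turn; congr cos; ring.
Qed.

(** Parseval's identity on the integers modulo [M]. *)
Lemma sum_energy : \sum_(i < M) energy (i%:R / M%:R) = M%:R * #|A|%:R.
Proof.
rewrite (eq_bigr _ (fun i _ => energyE _)).
rewrite exchange_big/=.
transitivity (\sum_(a in A) (M%:R : R)); last by rewrite sumr_const mulr_natr.
apply: eq_bigr => a aA; rewrite exchange_big/= (bigD1 a)//=.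
rewrite [X in X + _](eq_bigr (fun=> 1)) => [|i _]; last first.
  by rewrite subrr mul0r /turn mulr0 addr0 cos0.
rewrite sumr_const card_ord big1 ?addr0// => b /andP[bA ba].
have k0 : (a%:Z - b%:Z) != 0 by move: ba; rewrite -val_eqE /=; lia.
rewrite -[RHS](sum_cos_int k0).
  by apply: eq_bigr => i _; rewrite addr0 intrB -!pmulrn.
by have := ltn_ord a; have := ltn_ord b; lia.
Qed.

(** Bogolyubov's argument. The sum of [energy ^ 2] times the cosine of [n] counts the
representations of [- n] as [a - b + c - d] with entries in [A], in the integers
modulo [M = 4 N]; for [n < N] the congruences involved are equalities. The frequency 0
contributes the fourth power of [#|A|]; the frequencies of [B], where the energy
is large, contribute nonnegatively if their cosines at [n] are nonnegative, and the
others too little to cancel it. Parseval's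
identity bounds the number of elements of [B] in terms of the density of [A] only. *)
Lemma bogolyubov (L : nat) : (N <= L * #|A|)%N ->
  exists2 B : {set 'I_M}, (#|B| <= 32 * L ^ 2)%N &
  forall n : nat, (n < N)%N ->
    (forall i, i \in B -> 0 <= cos (turn (n%:R * (i%:R / M%:R)))) ->
    exists a b c d : 'I_N, [/\ a \in A, b \in A, c \in A & d \in A] /\
      (n + a + c = b + d)%N.
Proof.
move=> NLA.
have [K0 L0] : (0 < #|A|)%N /\ (0 < L)%N by apply/andP; rewrite -muln_gt0 mulnC; lia.
pose K : R := #|A|%:R.
have Kp : 0 < K by rewrite ltr0n.
have Lp : 0 < L%:R :> R by rewrite ltr0n.
(* The energy threshold, relative to the square of [#|A|], above which a
   frequency is put in [B]. *)
have [eta etap etaL] : exists2 eta : R, 0 < eta & eta * (8 * L%:R) = 1.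
  exists (8 * L%:R)^-1; first by rewrite invr_gt0 mulr_gt0.
  by rewrite mulVf// mulf_neq0// ?pnatr_eq0// -lt0n.
have NK : N%:R <= L%:R * K by rewrite -natrM ler_nat.
have MR : M%:R = 4 * N%:R :> R by rewrite ME natrM.
pose B := finset (fun i : 'I_M => eta * K ^+ 2 <= energy (i%:R / M%:R)).
exists B.
  have : #|B|%:R * (eta * K ^+ 2) <= M%:R * K.
    rewrite -sum_energy mulr_natl -sumr_const [leRHS](bigID (mem B))/=.
    rewrite -[leLHS]addr0 lerD ?sumr_ge0//; last by move=> i _; exact: energy_ge0.
    by apply: ler_sum => i; rewrite inE.
  rewrite expr2 !mulrA ler_pM2r// MR => h.
  suff : #|B|%:R * K <= 32 * L%:R ^+ 2 * K.
    by rewrite ler_pM2r// -natrX -natrM ler_nat.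
  have -> : #|B|%:R * K = #|B|%:R * eta * K * (8 * L%:R).
    by rewrite [RHS](_ : _ = #|B|%:R * K * (eta * (8 * L%:R))); [rewrite etaL mulr1|ring].
  apply: (@le_trans _ _ (4 * N%:R * (8 * L%:R))).
    by rewrite ler_pM2r// mulr_gt0.
  rewrite (_ : 32 * L%:R ^+ 2 * K = 4 * (L%:R * K) * (8 * L%:R)); last by ring.
  by rewrite ler_pM2r ?mulr_gt0// ler_pM2l.
move=> n nN posB; apply: contrapT => none.
pose Q := \sum_(i < M) energy (i%:R / M%:R) *
   (energy (i%:R / M%:R) * cos (turn (n%:R * (i%:R / M%:R)))).
have Q0 : Q = 0.
  rewrite /Q.
  under eq_bigr => i _ do rewrite energy_cos mulr_sumr.
  rewrite exchange_big/= big1// => a aA.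
  under eq_bigr => i _ do rewrite mulr_sumr.
  rewrite exchange_big/= big1// => b bA.
  under eq_bigr => i _ do rewrite energy_cos.
  rewrite exchange_big/= big1// => c cA.
  rewrite exchange_big/= big1// => d dA.
  pose k : int := n%:Z + a%:Z + c%:Z - b%:Z - d%:Z.
  rewrite -[RHS](@sum_cos_int k).
  - apply: eq_bigr => i _; congr cos.
    rewrite /k !intrB !intrD -!pmulrn /turn; ring.
  - apply/eqP => kE; apply: none; exists a, b, c, d; split => //.
    by rewrite /k in kE; lia.
  - rewrite /k; have := ltn_ord a; have := ltn_ord b; have := ltn_ord c.
    by have := ltn_ord d; lia.
pose t (i : 'I_M) := energy (i%:R / M%:R) *
   (energy (i%:R / M%:R) * cos (turn (n%:R * (i%:R / M%:R))))
   + eta * K ^+ 2 * energy (i%:R / M%:R).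
have t0 i : 0 <= t i.
  have e0 := energy_ge0 (i%:R / M%:R).
  rewrite /t; have [iB|iB] := boolP (i \in B).
    have cB := posB i iB.
    by rewrite addr_ge0 ?mulr_ge0 ?sqr_ge0// ltW.
  rewrite mulrC -mulrDl mulr_ge0//.
  have := cos_geN1 (turn (n%:R * (i%:R / M%:R))).
  rewrite inE -ltNge in iB; move: iB e0; set x := energy _; set y := cos _ => iB e0 y1.
  have : x * (-1) <= x * y by rewrite ler_wpM2l.
  by lra.
have : K ^+ 4 <= \sum_(i < M) t i.
  rewrite (bigD1 (Ordinal M0))//=; apply: (@le_trans _ _ (t (Ordinal M0))).
    rewrite /t /= mul0r mulr0 /turn mulr0 cos0 energy0 -/K mulr1.
    by rewrite -exprD lerDl !mulr_ge0// ?ltW// exprn_gt0.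
  by rewrite lerDl sumr_ge0.
rewrite big_split/= -/Q Q0 add0r -mulr_sumr sum_energy -/K MR.
apply/negP; rewrite -ltNge.
have -> : K ^+ 4 = K ^+ 3 * (eta * (8 * L%:R) * K) by rewrite etaL mul1r -exprSr.
have -> : eta * K ^+ 2 * (4 * N%:R * K) = K ^+ 3 * (eta * 4 * N%:R) by ring.
rewrite ltr_pM2l ?exprn_gt0// -mulrA -mulrA ltr_pM2l//.
have LK : 0 < L%:R * K by rewrite mulr_gt0.
by lra.
Qed.
End FiniteFourier.

Lemma continuous_mull (R : realType) (Z : topologicalType) (c : R) (f : Z -> R) :
  continuous f -> continuous (fun z => c * f z).
Proof. by move=> fc z; apply: cvgM; [exact: cvg_cst|exact: fc]. Qed.

Section BohrNeighbourhood.
Variables (R : realType) (G : topologicalZmodType).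

Lemma four_fold_nbhs (U : set G) : nbhs 0 U -> exists2 V : set G, nbhs 0 V &
  forall a b c d, V a -> V b -> V c -> V d -> U (b - a + (d - c)).
Proof.
move=> U0.
have sub_near (W : set G) : nbhs 0 W -> exists2 V : set G, nbhs 0 V &
    forall a b, V a -> V b -> W (b - a).
  move=> W0; have := @sub_continuous G (0, 0) W; rewrite /= subr0 => /(_ W0).
  move=> [[A B] /= [A0 B0] ABW]; exists (A `&` B); first exact: filterI.
  by move=> a b [_ Ba] [Ab _]; apply: (ABW (b, a)).
have := @add_continuous G (0, 0) U; rewrite /= addr0 => /(_ U0).
move=> [[A B] /= [A0 B0] ABU].
have [V V0 VW] := sub_near (A `&` B) (filterI A0 B0).
exists V => // a b c d Va Vb Vc Vd; apply: (ABU (b - a, d - c)).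
by split; [case: (VW a b)|case: (VW c d)].
Qed.

(** Near-covering compactness, along the filter of finite sequences directed by
inclusion. *)
Lemma finite_translates (V : set G) : compact [set: G] -> nbhs 0 V ->
  exists s : seq G, forall y, exists2 x, x \in s & V (y - x).
Proof.
move=> /compact_near_coveringP cov V0.
pose F := filter_from [set: seq G] (fun s => [set s' : seq G | {subset s <= s'}]).
have FF : Filter F.
  apply: filter_from_filter; first by exists [::].
  move=> s s' _ _; exists (s ++ s') => // s'' sub.
  by split=> x xs; apply: sub; rewrite mem_cat xs ?orbT.
have [x _|s _ sP] := cov _ F (fun (s : seq G) y => exists2 x, x \in s & V (y - x)) FF.
  exists ([set y | V (y - x)], [set s : seq G | x \in s]) => /=; last first.
    by move=> [y s] /= [Vy xs]; exists x.
  split; last by exists [:: x] => // s; apply; exact: mem_head.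
  have := @sub_continuous G (x, x) V; rewrite /= subrr => /(_ V0).
  move=> [[A B] /= [Ax Bx] ABV]; apply: filterS Ax => y Ay.
  by apply: (ABV (y, x)); split => //; exact: nbhs_singleton Bx.
by exists s => y; exact: (sP s).
Qed.

(** Some translate of a small [V] contains [g *+ n] for a positive proportion of the
[n < N]; apply [bogolyubov] to these [n]. The number [r] of frequencies does not
depend on [N]. *)
Lemma bohr_finite (g : G) (U : set G) : compact [set: G] -> nbhs 0 U ->
  exists r, forall N, (0 < N)%N -> exists alpha : 'I_r -> R,
    (forall i, 0 <= alpha i <= 1) /\
    forall n, (n < N)%N -> (forall i, 0 <= cos (turn (n%:R * alpha i))) ->
      U (g *+ n).
Proof.
move=> cG U0; have [V V0 VU] := four_fold_nbhs U0.
have [s sP] := finite_translates cG V0.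
pose L := size s; exists (32 * L ^ 2)%N => N N0.
have /choice[x xP] (n : 'I_N) : exists i : 'I_L, V (g *+ n - nth 0 s i).
  have [x xs Vx] := sP (g *+ n).
  have xL : (index x s < L)%N by rewrite index_mem.
  by exists (Ordinal xL); rewrite /= nth_index.
pose A (i : 'I_L) : {set 'I_N} := finset (fun n : 'I_N => x n == i).
have [i iA] : exists i, (N <= L * #|A i|)%N.
  apply: contrapT => /forallNP none.
  have NE : N = (\sum_(i < L) #|A i|)%N.
    rewrite -[LHS]card_ord -sum1_card (partition_big x predT)//=.
    by apply: eq_bigr => i _; rewrite -sum1_card; apply: eq_bigl => n; rewrite inE.
  have : (L * N <= \sum_(i < L) (L * #|A i|))%N by rewrite -big_distrr /= -NE.
  apply/negP; rewrite -ltnNge.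
  have L0 : (0 < L)%N := leq_ltn_trans (leq0n _) (ltn_ord (x (Ordinal N0))).
  apply: (@leq_ltn_trans (\sum_(i < L) N.-1)%N).
    by apply: leq_sum => i _; rewrite -ltnS prednK// ltnNge; apply/negP/none.
  by rewrite sum_nat_const card_ord ltn_pmul2l// prednK.
have [B BL BP] := bogolyubov R (erefl (4 * N)%N) N0 iA.
pose al (i : 'I_(4 * N)) : R := i%:R / (4 * N)%:R.
(* The frequencies in [B], padded with 0, at which the cosine condition is void. *)
exists (fun j => nth 0 (map al (enum B)) j); split => [j|n nN pos].
  have [jB|jB] := ltnP j (size (enum B)); last first.
    by rewrite nth_default ?size_map// lexx ler01.
  have [b _] : exists b : 'I_(4 * N), true.
    by exists (Ordinal (ltn_addr _ N0 : 0 < 4 * N)%N).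
  rewrite (nth_map b)// /al divr_ge0//= ler_pdivrMr ?ltr0n ?muln_gt0//.
  by rewrite mul1r ler_nat ltnW.
have [|a [b [c [d [[aA bA cA dA] E]]]]] := BP n nN.
  move=> k kB; have kE : (index k (enum B) < 32 * L ^ 2)%N.
    by apply: leq_trans BL; rewrite cardE index_mem mem_enum.
  by have := pos (Ordinal kE); rewrite /= (nth_map k) ?index_mem ?mem_enum//
    nth_index ?mem_enum.
have VA (k : 'I_N) : k \in A i -> V (g *+ k - nth 0 s i).
  by rewrite inE => /eqP <-; exact: xP.
have := VU _ _ _ _ (VA _ aA) (VA _ bA) (VA _ cA) (VA _ dA).
congr U; move: (nth 0 s i) => y.
have -> : g *+ b - y - (g *+ a - y) + (g *+ d - y - (g *+ c - y)) =
  (g *+ b + g *+ d) - (g *+ a + g *+ c).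
  by rewrite !opprB !subrKA opprD addrACA.
by rewrite -!mulrnDr -E -addnA mulrnDr addrK.
Qed.

(** A neighbourhood of 0 contains [g *+ n] as soon as [n] almost annihilates finitely
many elements of the circle: these are a cluster point, in a finite dimensional
cube, of the frequencies that [bohr_finite] gives for the ranges [n <= N]. *)
Lemma bohr_neighbourhood (g : G) (U : set G) : compact [set: G] -> nbhs 0 U ->
  exists s : seq R, forall n : nat,
    (forall a, a \in s -> cball 0 (1/8) (n%:R * a)) -> U (g *+ n).
Proof.
move=> cG U0; have [r rP] := bohr_finite g cG U0.
have /choice[al alP] (N : nat) := rP N.+1 (ltn0Sn N).
pose v N : 'rV[R]_r := \row_i al N i.
pose K : set 'rV[R]_r := [set w | forall i, `[0, 1]%classic (w ord0 i)].
have cK : compact K.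
  by apply: (@rV_compact R r (fun=> `[0, 1]%classic)) => i; exact: segment_compact.
have vK : (v @ \oo) K.
  by exists 0%N => // N _ i /=; rewrite mxE in_itv /=; exact: (alP N).1.
have [w [_ wcl]] := cK (v @ \oo) _ vK.
exists [seq w ord0 i | i <- enum 'I_r] => n nw.
pose W : set 'rV[R]_r := [set u | forall i, `|n%:R * w ord0 i - n%:R * u ord0 i| < 1/8].
have Ww : nbhs w W.
  have Wi (i : 'I_r) : nbhs w
      [set u : 'rV[R]_r | `|n%:R * w ord0 i - n%:R * u ord0 i| < 1/8].
    have c8 : continuous (fun u : 'rV[R]_r => n%:R * u ord0 i).
      exact: (continuous_mull (@coord_continuous R 1 r ord0 i)).
    by have /cvgrPdist_lt := c8 w; apply; rewrite divr_gt0.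
  exact: (filter_forall (nbhs_filter w) Wi).
have Nn : (v @ \oo) [set u | exists2 N, (n < N.+1)%N & u = v N].
  by exists n => // N /= nN; exists N.
have [_ [[N nN ->] WN]] := wcl _ _ Nn Ww.
apply: ((alP N).2 n nN) => i; apply: cos_turn_ge0.
rewrite (_ : 1 / 4 = 1/8 + 1/8); last by lra.
apply: (@cball_triangle _ _ (n%:R * w ord0 i)).
  by apply: nw; apply: map_f; rewrite mem_enum.
by apply: cball_norm; have := WN i; rewrite mxE.
Qed.

End BohrNeighbourhood.

(** * Polynomial phases on tori *)

(** Insert the elements of [l] one at a time. An element that depends rationally on the
previous ones is absorbed by multiplying [q] by its coefficient in the relation. *)
Lemma free_mod1_basis (R : realType) (l : seq R) :
  exists q s b, [/\ (0 < q)%N, free_mod1 s b & forall x, x \in l ->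
    exists c : nat -> int, q%:R * x - \sum_(i < s) (c i)%:~R * b i \is a Num.int].
Proof.
elim: l => [|x l [q [s [b [q0 bf bl]]]]].
  by exists 1%N, 0%N, (fun=> 0); split => // c _ [].
pose b' i := if i == s then x else b i.
have sumS (c : nat -> int) : \sum_(i < s.+1) (c i)%:~R * b' i =
    \sum_(i < s) (c i)%:~R * b i + (c s)%:~R * x.
  rewrite big_ord_recr /= {2}/b' eqxx; congr (_ + _).
  by apply: eq_bigr => i _; rewrite /b' ltn_eqF.
have [b'f|/existsNP[c /not_implyP[cZ /existsNP[i0 /not_implyP[i0s ci0]]]]] :=
    pselect (free_mod1 s.+1 b').
  exists q, s.+1, b'; split => // y; rewrite inE => /predU1P[->|yl].
    pose c i := if i == s then q%:Z else 0.
    exists c; rewrite (sumS c) /c eqxx.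
    rewrite big1 => [|i _]; last by rewrite ltn_eqF// mul0r.
    by rewrite add0r -pmulrn subrr rpred0.
  have [c cP] := bl y yl; pose c0 i := if i == s then 0 else c i.
  exists c0; rewrite (sumS c0) /c0 eqxx mul0r addr0; apply: int_congr cP _; congr (_ - _).
  by apply: eq_bigr => i _; rewrite ltn_eqF.
rewrite sumS in cZ.
have m0 : c s != 0.
  apply/negP => /eqP m0; apply: ci0; move: i0s; rewrite ltnS leq_eqVlt.
  move=> /predU1P[->//|]; apply: bf.
  by move: cZ; rewrite m0 mul0r addr0.
have mE : `|c s|%N%:R = (sgz (c s))%:~R * (c s)%:~R :> R.
  by rewrite -intrM -abszEsg pmulrn.
exists (q * `|c s|)%N, s, b; split => //; first by rewrite muln_gt0 q0 absz_gt0.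
move=> y; rewrite inE => /predU1P[->|yl].
  exists (fun i => - (q%:Z * sgz (c s) * c i)).
  have -> : \sum_(i < s) (- (q%:Z * sgz (c s) * c i))%:~R * b i =
      - (q%:R * (sgz (c s))%:~R) * \sum_(i < s) (c i)%:~R * b i.
    rewrite mulr_sumr; apply: eq_bigr => i _.
    by rewrite mulrNz !intrM -pmulrn; ring.
  apply: int_congr (rpredM (rpredM (rpred_nat _ q) (intr_int _ (sgz (c s)))) cZ) _.
  by rewrite natrM mE; ring.
have [c' cP] := bl y yl; exists (fun i => `|c s|%N%:Z * c' i).
have -> : \sum_(i < s) (`|c s|%N%:Z * c' i)%:~R * b i =
    `|c s|%N%:R * \sum_(i < s) (c' i)%:~R * b i.
  by rewrite mulr_sumr; apply: eq_bigr => i _; rewrite intrM -pmulrn mulrA.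
apply: int_congr (rpredM (rpred_nat _ `|c s|%N) cP) _.
by rewrite natrM; ring.
Qed.

Section TorusTheorem.
Variables (R : realType) (X : topologicalType) (T : X -> X) (Y : set X).
Hypotheses (Tc : continuous T) (TY : T @` Y `<=` Y) (YU : Y `<=` universal T).
Hypotheses (Y0 : Y !=set0) (lpc : locally_path_connected R Y)
  (sc : simply_connected R Y).

(** Apply [extension_dichotomy] to the rotation by [1/q]. In the case of a transfer
function, [rotation_number] shows that [m/q] is an integer, hence the multiples of
[1/q] are among the displacements [h] with [reach u u h]. In both cases every [z]
is reached with phase 0, that is along multiples of [q]. *)
Lemma universal_power q : (0 < q)%N -> Y `<=` universal (iter q T).
Proof.
move=> q0 u Yu.
have qR : 0 < q%:R :> R by rewrite ltr0n.
pose phi (z : X) : R := q%:R^-1.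
have phic : continuous (phi : X -> circ R) by move=> z; exact: cvg_cst.
have birkE n z : birkhoff T phi n z = n%:R / q%:R.
  by rewrite /birkhoff sumr_const card_ord mulr_natl.
suff r0 z : reach T phi u z 0.
  move=> U [z Uz] Uo; have Wz := open_nbhs_nbhs (conj Uo Uz).
  have q0' : 0 < q%:R^-1 :> R by rewrite invr_gt0.
  have [n [n1 Un]] := r0 z U _ Wz q0'; rewrite birkE => -[_ /intrP[k ->]].
  rewrite sub0r => nk.
  have : `|n%:Z + k * q%:Z| < 1.
    have : `|(n%:Z + k * q%:Z)%:~R| < 1 :> R; last first.
      by rewrite -intr_norm -[1]/(1%:~R) ltr_int.
    move: nk; rewrite -(ltr_pM2l qR) -[X in X * `|_|]gtr0_norm// -normrM.
    rewrite divff ?gt_eqF// -normrN; congr (`| _ | < _).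
    by rewrite intrD intrM -!pmulrn; field; rewrite gt_eqF.
  move=> nkq.
  have /dvdnP[n' nE] : (q %| n)%N.
    have -> : n = absz (k * q%:Z) by lia.
    by rewrite abszM dvdn_mull.
  exists (iter n T u); split => //; exists n'.
    by move: n1; rewrite nE muln_gt0 => /andP[].
  by rewrite nE; elim: n' {nE nkq} => // m IH; rewrite mulSn iterD IH.
have [//|[m [f [m0 Hm fc fS]]]] := extension_dichotomy Tc phic YU TY Yu.
have mq : (m%:R / q%:R : R) \is a Num.int.
  apply: (rotation_number Tc YU TY (f := fun y : Y => f (set_val y)) Y0 lpc sc).
    move=> y; apply: (@continuous_comp _ _ (circ R) set_val f).
      exact: initial_continuous.
    by apply: fc; exact: set_valP.
  by move=> y y' ->; exact: fS (set_valP y).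
apply: (reach_closed) => W e Wz e0.
have [n n1 Wn] := universal_hit (YU Yu) Wz.
exists (iter n T u), 0; split => //; first exact: cball_center.
rewrite -(addNr (birkhoff T phi n u)).
apply: (reach_trans Tc phic) (@reach_iter R X T phi n u n1).
apply: Hm; rewrite birkE mulrN rpredN mulrCA.
by rewrite rpredM ?rpred_nat.
Qed.


Section Phases.
Variables (s : nat) (b : nat -> R) (S : X -> X) (u x : X) (K : nat).
Hypothesis s0 : (0 < s)%N.
Let D := (K * s)%N.
Local Notation SD := (@tower_map R X S s b D).

Lemma phase_coord_pt E i (y : X) : phase_coord i (tower_pt R E y) = 0.
Proof. by elim: E => //= E IH; case: ifP. Qed.

Lemma phase_coord_iter n i : (i < D)%N ->
  phase_coord i (iter n SD (tower_pt R D u)) =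
  'C(n, (i %/ s).+1)%:R * b (i %% s)%N.
Proof.
elim: n i => [|n IH] i iD; first by rewrite /= phase_coord_pt bin0n mul0r.
rewrite iterS phase_coord_tower_map// IH// binS natrD mulrDl; congr (_ + _).
case: ltnP => [si|si]; first by rewrite divn_small// bin0 mul1r modn_small.
rewrite IH; last exact: leq_ltn_trans (leq_subr _ _) iD.
have iE : i = (i - s + s)%N by rewrite subnK.
by rewrite [in RHS]iE modnDr divnDr ?dvdnn// divnn s0 addn1.
Qed.

(** The sequence [psi] is, modulo 1, the restriction to the orbit of the base point
of a continuous circle-valued function vanishing above [x]. *)
Definition tower_readable (psi : nat -> R) : Prop :=
  exists Phi : tower R X D -> R, [/\ continuous (Phi : tower R X D -> circ R),
    Phi (tower_pt R D x) = 0 &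
    forall n, Phi (iter n SD (tower_pt R D u)) - psi n \is a Num.int].

Lemma readableD f g : tower_readable f -> tower_readable g ->
  tower_readable (fun n => f n + g n).
Proof.
move=> [F [Fc F0 FP]] [H [Hc H0 HP]]; exists (fun z => F z + H z); split.
- by move=> z; apply: circ_cvgD; [exact: Fc|exact: Hc].
- by rewrite F0 H0 addr0.
- by move=> n; apply: int_congr (rpredD (FP n) (HP n)) _; ring.
Qed.

Lemma readable_congr f g : tower_readable f ->
  (forall n, f n - g n \is a Num.int) -> tower_readable g.
Proof.
move=> [F [Fc F0 FP]] fg; exists F; split => // n.
by apply: int_congr (rpredD (FP n) (fg n)) _; ring.
Qed.

Lemma readable0 : tower_readable (fun=> 0).
Proof.
exists (fun=> 0); split => // [z|n]; first exact: cvg_cst.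
by rewrite subrr.
Qed.

Lemma readableN f : tower_readable f -> tower_readable (fun n => - f n).
Proof.
move=> [F [Fc F0 FP]]; exists (fun z => - F z); split.
- by move=> z; apply: circ_cvgN; exact: Fc.
- by rewrite F0 oppr0.
- by move=> n; rewrite -opprD rpredN.
Qed.

Lemma readable_nat f m : tower_readable f -> tower_readable (fun n => m%:R * f n).
Proof.
move=> rf; elim: m => [|m IH].
  by apply: readable_congr readable0 _ => n; rewrite mul0r subrr.
apply: readable_congr (readableD IH rf) _ => n.
by rewrite -natr1 mulrDl mul1r subrr.
Qed.

Lemma readable_int f (k : int) : tower_readable f ->
  tower_readable (fun n => k%:~R * f n).
Proof.
move=> rf; case: k => m; first exact: readable_nat.
apply: readable_congr (readableN (readable_nat m.+1 rf)) _ => n.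
by rewrite NegzE mulrNz -pmulrn mulNr subrr.
Qed.

Lemma readable_sum (I : Type) (r : seq I) (f : I -> nat -> R) :
  (forall i, tower_readable (f i)) ->
  tower_readable (fun n => \sum_(i <- r) f i n).
Proof.
move=> rf; elim: r => [|i r IH].
  by apply: readable_congr readable0 _ => n; rewrite big_nil subrr.
by apply: readable_congr (readableD (rf i) IH) _ => n; rewrite big_cons subrr.
Qed.

(** From the binomial coefficients to the powers of [n], by means of
[n 'C(n, l) = (l + 1) 'C(n, l + 1) + l 'C(n, l)]. *)
Lemma readable_power i k : (i < s)%N -> (0 < k <= K)%N ->
  tower_readable (fun n => n%:R ^+ k * b i).
Proof.
move=> si /andP[k0 kK].
suff H j l : (0 < l)%N -> (l + j <= K)%N ->
    tower_readable (fun n => n%:R ^+ j * 'C(n, l)%:R * b i).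
  apply: readable_congr (H k.-1 1%N isT _) _ => [|n]; first by rewrite add1n prednK.
  by rewrite bin1 -exprSr prednK// subrr.
elim: j l => [|j IH] l l0 lK.
  have iD : (l.-1 * s + i < D)%N.
    apply: (@leq_trans (l.-1 * s + s)); first by rewrite ltn_add2l.
    by rewrite -mulSnr prednK// leq_mul2r -(addn0 l) lK orbT.
  exists (fun z => phase_coord (l.-1 * s + i) z); split => [|  |n].
  - exact: phase_coord_continuous.
  - exact: phase_coord_pt.
  - rewrite phase_coord_iter// divnMDl// divn_small// addn0 prednK//.
    by rewrite modnMDl modn_small// expr0 mul1r subrr.
have l1K : (l.+1 + j <= K)%N by rewrite addSnnS.
have l2K : (l + j <= K)%N by rewrite (leq_trans _ l1K)// addSn.
have r1 := readable_nat l.+1 (IH l.+1 isT l1K).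
have r2 := readable_nat l (IH l l0 l2K).
apply: readable_congr (readableD r1 r2) _ => n.
have nC : n%:R * 'C(n, l)%:R = l.+1%:R * 'C(n, l.+1)%:R + l%:R * 'C(n, l)%:R :> R.
  rewrite -!natrM -natrD mul_bin_left -mulnDl; congr (_%:R).
  by have [ln|nl] := leqP l n; [rewrite subnK|rewrite bin_small// !muln0].
by rewrite exprSr -[_ * n%:R * _]mulrA nC [X in X \is a _](_ : _ = 0) ?rpred0//; ring.
Qed.

End Phases.

Fixpoint tower_base (D : nat) : tower R X D -> X :=
  match D with 0 => id | D'.+1 => fun z => @tower_base D' z.1 end.

Lemma tower_base_continuous D : continuous (@tower_base D).
Proof.
elim: D => [|D IH] z /=; first exact: cvg_id.
by apply: (@continuous_comp _ _ _ fst (@tower_base D)); [exact: cvg_fst|exact: IH].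
Qed.

Lemma tower_base_iter S s b D n z :
  tower_base (iter n (@tower_map R X S s b D) z) = iter n S (tower_base z).
Proof.
elim: n => //= n <-; move: (iter n _ z) => {}z.
by elim: D z => //= D IH z.
Qed.

Lemma tower_base_pt D (y : X) : tower_base (tower_pt R D y) = y.
Proof. by elim: D. Qed.

(** Replace [T] by [iter q T] and the phases by a basis [b], independent from 1: for
[k >= 1] the phase [(n q)^k a] is modulo 1 an integral combination of the
[n^k b i], hence [tower_readable]. The orbit of the base point of the tower is
dense, and visits a neighbourhood of the point above [x] with zero phases. *)
Theorem torus_phases (l : seq R) (K : nat) (u x : X) (W : set X) (e : R) :
  Y u -> nbhs x W -> 0 < e ->
  exists n, [/\ (1 <= n)%N, W (iter n T u) & forall a k, a \in l ->
    (0 < k <= K)%N -> cball 0 e ((n ^ k)%:R * a)].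
Proof.
move=> Yu Wx e0.
have [q [s [b [q0 bf bl]]]] := free_mod1_basis l.
pose Tq := iter q T.
have Tqc : continuous Tq by exact: iter_continuous.
have TqY : Tq @` Y `<=` Y by move=> _ [y Yy <-]; exact: invariant_iter.
have TqU : Y `<=` universal Tq by exact: universal_power.
pose D := (K * s)%N.
have D0 : (0 < s)%N \/ D = 0%N.
  by rewrite /D; case: (s) => [|s']; [right; rewrite muln0|left].
have towU := @tower_universal R X Tq Y s b Tqc TqY TqU Y0 lpc sc bf D D0.
pose w := tower_pt R D u; pose v := tower_pt R D x.
have wU := towU w (tower_set_pt R D Yu).
have readable a k : a \in l -> (0 < k <= K)%N ->
    tower_readable s b Tq u x K (fun n => ((n * q) ^ k)%:R * a).
  move=> al k0K; have [c cP] := bl a al.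
  have k1 : (0 < k)%N by case/andP: (k0K).
  apply: (@readable_congr _ _ _ _ _ _ (fun n => \sum_(i <- enum 'I_s)
    ((q ^ k.-1)%N%:Z * c i)%:~R * (n%:R ^+ k * b i))).
    apply: readable_sum => i; apply: readable_int.
    by apply: readable_power => //; exact: leq_ltn_trans (leq0n _) (ltn_ord i).
  move=> n; rewrite big_enum /=.
  have -> : \sum_(i < s) ((q ^ k.-1)%N%:Z * c i)%:~R * (n%:R ^+ k * b i) =
      q%:R ^+ k.-1 * n%:R ^+ k * \sum_(i < s) (c i)%:~R * b i.
    rewrite mulr_sumr; apply: eq_bigr => i _.
    by rewrite intrM -pmulrn natrX; ring.
  apply: int_subC.
  apply: int_congr (rpredM (rpred_nat _ (q ^ k.-1 * n ^ k)%N) cP) _.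
  rewrite expnMn !natrM !natrX -{2}(prednK k1) exprS; ring.
pose V (p : 'I_(size l) * 'I_K) : set (tower R X D) := [set z |
  forall n, z = iter n (@tower_map R X Tq s b D) w ->
  cball 0 e (((n * q) ^ p.2.+1)%:R * l`_p.1)].
have Vv p : nbhs v (V p).
  have [Phi [Phic Phi0 PhiP]] := 
    readable _ p.2.+1 (mem_nth 0 (ltn_ord p.1)) (ltn_ord p.2).
  have Phiv : nbhs v [set z | cball 0 e (Phi z)].
    rewrite -Phi0; exact: (proj1 (circ_cvgP _ _ _) (Phic v) e e0).
  apply: filterS Phiv => z zP n zE; rewrite /= zE in zP.
  exact: cball_intr (PhiP n) zP.
have Wv : nbhs v (@tower_base D @^-1` W).
  by apply: tower_base_continuous; rewrite tower_base_pt.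
have [n n1 [/= Vn Wn]] := universal_hit wU
  (filterI (filter_forall (nbhs_filter v) Vv) Wv).
exists (n * q)%N; split.
- by rewrite muln_gt0 n1.
- by move: Wn; rewrite tower_base_iter tower_base_pt /Tq iterM.
move=> a k al /andP[k0 kK].
have il : (index a l < size l)%N by rewrite index_mem.
have kK' : (k.-1 < K)%N by rewrite prednK.
by have := Vn (Ordinal il, Ordinal kK') n erefl; rewrite /= prednK// nth_index.
Qed.

End TorusTheorem.

(** * Polynomial phases in compact groups *)

(** Boxes form a neighbourhood base, since the index set is finite. *)
Lemma ptws_nbhs (I : finType) (G : topologicalType) (h : I -> G)
  (C : set {ptws I -> G}) : nbhs (h : {ptws I -> G}) C ->
  exists2 U : I -> set G, forall i, nbhs (h i) (U i) &
    forall w : I -> G, (forall i, U i (w i)) -> C w.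
Proof.
pose F : set_system {ptws I -> G} := filter_from
  [set U : I -> set G | forall i, nbhs (h i) (U i)]
  (fun U => [set w | forall i, U i (w i)]).
have FF : Filter F.
  apply: filter_from_filter; first by exists (fun=> setT) => i; exact: filterT.
  move=> U V hU hV; exists (fun i => U i `&` V i).
    by move=> i; exact: filterI.
  by move=> w UVw; split=> i; case: (UVw i).
suff FC : F --> (h : {ptws I -> G}) by move=> /FC [U hU UC]; exists U.
apply/cvg_sup => i A [_ [[W Wo <-] /= Wh WC]].
exists (fun j => if j == i then W else setT).
  move=> j; case: eqP => [->|_]; last exact: filterT.
  exact: open_nbhs_nbhs.
by move=> w /(_ i); rewrite eqxx => Ww; apply: WC.
Qed.

Theorem mainTheorem5 (R : realType) (X : topologicalType) (T : X -> X)
    (hT : continuous T) (p : nat) (hp : (1 <= p)%N)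
    (G : topologicalZmodType) (hG : compact [set: G])
    (g : 'I_p -> G) (d : 'I_p -> nat) (hd : forall j, (1 <= d j)%N)
    (Y : set X) (Y0 : Y !=set0) (YU : Y `<=` universal T)
    (TY : T @` Y `<=` Y) (Ypc : path_connected R Y)
    (Ylpc : locally_path_connected R Y) (Ysc : simply_connected R Y) :
  forall u : X, Y u ->
    [set: X] `*` [set (fun=> 0) : {ptws phase_index d -> G}]
      `<=` orbit_closure T g d u.
Proof.
move=> u Yu [x h] [_ /= ->] B [[A C] /= [Ax C0] ACB].
have [U U0 UC] := @ptws_nbhs {j : 'I_p & 'I_(d j)} G (fun=> 0) C C0.
have /choice[s sP] (i : {j : 'I_p & 'I_(d j)}) :=
  bohr_neighbourhood R (g (tag i)) hG (U0 i).
pose K := \max_(j < p) d j.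
have e8 : 0 < 1 / 8 :> R by rewrite divr_gt0.
have [n [n1 An nP]] := torus_phases hT TY YU Y0 Ylpc Ysc
  (flatten [seq s i | i : {j : 'I_p & 'I_(d j)}]) K Yu Ax e8.
exists (iter n T u, phases g d n); split; first by exists n.
apply: ACB; split => //=; apply: UC => i; apply: sP => a ai; apply: nP.
  by apply/flattenP; exists (s i) => //; apply: map_f; rewrite mem_enum.
have := ltn_ord (tagged i); rewrite subn_gt0 => -> /=.
by apply: leq_trans (leq_subr _ _) _; exact: (@leq_bigmax _ d (tag i)).
Qed.
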